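(* For each tuatara machine $V$ there effectively exists a self-delimiting Turing machine $C$ such that $\Omega_C=\zeta_V$. If $V$ is a universal tuatara machine, then $C$ can be taken to be a universal self-delimiting Turing machine.
   Context: Turing machines map binary strings to binary strings (partial functions on $\Sigma^*$, $\Sigma=\{0,1\}$); $\mathrm{dom}(M)$ is the set of inputs on which $M$ halts; $M$ is self-delimiting if $\mathrm{dom}(M)$ is prefix-free. $\mathrm{bin}:\mathbf{N}=\{1,2,\dots\}\to\Sigma^*$ is the bijection sending $n$ to its binary expansion with the leading 1 removed. $\Omega_M=\sum_{p\in\mathrm{dom}(M)}2^{-|p|}$, $\zeta_M=\sum_{n\ge1,\ \mathrm{bin}(n)\in\mathrm{dom}(M)}\frac1n$. $M$ is a tuatara machine if $\zeta_M\le1$. A Turing machine $W$ is universal for a class $\Re$ of Turing machines if for every $C\in\Re$ there is a constant $c\ge0$ such that for every $x\in\mathrm{dom}(C)$ there is $p_x\in\mathrm{dom}(W)$ with $|p_x|\le|x|+c$ and $W(p_x)=C(x)$; a universal tuatara machine is a tuatara machine universal for the class of tuatara machines, and a universal self-delimiting Turing machine is a self-delimiting machine universal for the class of self-delimiting machines. *)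

(* Defs.v *)
From HB Require Import structures.
From mathcomp Require Import all_boot all_order all_algebra.
From mathcomp Require Import all_classical all_reals all_analysis.
Set Implicit Arguments.
Unset Strict Implicit.
Unset Printing Implicit Defensive.
Import Order.TTheory GRing.Theory Num.Theory.
Local Open Scope classical_set_scope.

(* Turing machines with one two-way infinite tape.  States and tape symbols
   are natural numbers, of which a given machine mentions only finitely many:
   state 0 is initial, symbol 0 is the blank, symbols 1 and 2 are the binary
   digits 0 and 1, and the other symbols are auxiliary. *)
Inductive move := MoveL | MoveR.

(* In state [istate], scanning [iread]: write [iwrite], move the head by
   [imove] and enter state [inext]. *)
Record instr := Instr {
  istate : nat; iread : nat; inext : nat; iwrite : nat; imove : move }.

(* If several instructions apply, the first one in the list is executed, so
   that every list is a deterministic machine; the machine halts when none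
   applies. *)
Definition machine := seq instr.

(* [ltape] lists the cells to the left of the head, nearest first; [rtape]
   lists the scanned cell followed by the cells to its right.  All the cells
   that are not listed are blank. *)
Record config := Config { cstate : nat; ltape : seq nat; rtape : seq nat }.

Definition lookup (M : machine) (q s : nat) : option instr :=
  ohead [seq i <- M | (istate i == q) && (iread i == s)].

Definition exec (i : instr) (c : config) : config :=
  match imove i with
  | MoveR => Config (inext i) (iwrite i :: ltape c) (behead (rtape c))
  | MoveL => Config (inext i) (behead (ltape c))
               (head 0 (ltape c) :: iwrite i :: behead (rtape c))
  end.

Definition step (M : machine) (c : config) : option config :=
  omap (exec^~ c) (lookup M (cstate c) (head 0 (rtape c))).

(* The head starts on the first digit of the input. *)
Definition init (x : seq bool) : config :=
  Config 0 [::] [seq (nat_of_bool b).+1 | b <- x].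

(* The output is the longest block of binary digits that starts at the head. *)
Fixpoint digits (t : seq nat) : seq bool :=
  match t with
  | 1 :: t' => false :: digits t'
  | 2 :: t' => true :: digits t'
  | _ => [::]
  end.

(* [computes M x y]: M halts on input x, with output y. *)
Definition computes (M : machine) (x y : seq bool) : Prop :=
  exists n c, [/\ iter n (obind (step M)) (Some (init x)) = Some c,
                  step M c = None & digits (rtape c) = y].

Lemma computes_functional (M : machine) (x y z : seq bool) :
  computes M x y -> computes M x z -> y = z.
Proof.
move=> [n [c [Hn Hc <-]]] [m [d [Hm Hd <-]]].
have halt k a b e : iter k (obind (step M)) (Some a) = Some b ->
    step M b = None -> iter (e + k).+1 (obind (step M)) (Some a) = None.
  by move=> Hk Hb; elim: e => [|e IH]; [rewrite iterS Hk /= | rewrite addSn iterS IH].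
case: (ltngtP n m) => [lt|lt|E].
- by have := halt _ _ _ (m - n.+1) Hn Hc; rewrite -addnS subnK// Hm.
- by have := halt _ _ _ (n - m.+1) Hm Hd; rewrite -addnS subnK// Hn.
- by move: Hm; rewrite -E Hn => -[->].
Qed.

Definition dom (M : machine) : set (seq bool) :=
  [set x | exists y, computes M x y].

(* Encoding of machines by binary strings: an instruction is written as four
   numbers in unary, each ended by a 0, followed by one bit for the move. *)
Definition code_nat (n : nat) : seq bool := rcons (nseq n true) false.

Definition code_instr (i : instr) : seq bool :=
  code_nat (istate i) ++ code_nat (iread i) ++ code_nat (inext i) ++
  code_nat (iwrite i) ++ [:: if imove i is MoveR then true else false].

Definition code (M : machine) : seq bool := flatten (map code_instr M).

Lemma code_inj : injective code.
Proof.
have cn a b s t : code_nat a ++ s = code_nat b ++ t -> a = b /\ s = t.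
  by elim: a b => [|a IH] [|b] //= [] // /IH [-> ->].
elim=> [|[a b c d m] M IH] [|[a' b' c' d' m'] N] //; rewrite /code /= /code_instr /=.
- by case: a'.
- by case: a.
rewrite -!catA => /cn[-> /cn[-> /cn[-> /cn[-> /= [E /IH ->]]]]].
by case: m m' E => [] [].
Qed.

(* "For each V in the class K there effectively exists C such that P V C": a
   single Turing machine transforms the code of any V in K into the code of
   such a C. *)
Definition effectively_exists (K : set machine)
    (P : machine -> machine -> Prop) : Prop :=
  exists F : machine, forall V, K V ->
    exists C, computes F (code V) (code C) /\ P V C.

(* The binary expansion of n, most significant digit first, without its leading
   1; it is only meant for n > 0. *)
Definition bin (n : nat) : seq bool :=
  let k := trunc_log 2 n in mkseq (fun i => odd (n %/ 2 ^ (k - i.+1))) k.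

Local Open Scope ring_scope.

Definition Omega (R : realType) (M : machine) : \bar R :=
  \esum_(p in dom M) ((2 : R) ^- size p)%:E.

Definition zeta (R : realType) (M : machine) : \bar R :=
  \esum_(n in [set n | (0 < n)%N /\ dom M (bin n)]) (n%:R^-1 : R)%:E.

Definition self_delimiting (M : machine) : Prop :=
  forall p q, dom M p -> dom M q -> prefix p q -> p = q.

Definition tuatara (R : realType) (M : machine) : Prop := (zeta R M <= 1)%E.

Definition universal_for (K : set machine) (W : machine) : Prop :=
  forall C, K C -> exists c : nat, forall x y, computes C x y ->
    exists p, (size p <= size x + c)%N /\ computes W p y.

Definition universal_tuatara (R : realType) (W : machine) : Prop :=
  tuatara R W /\ universal_for (tuatara R) W.

Definition universal_self_delimiting (W : machine) : Prop :=
  self_delimiting W /\ universal_for self_delimiting W.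

(* Main.v *)
(* Enumerate the halting computations of V.  A computation that halts on bin n
   adds 1/n to a running sum, so that the t-th one claims the interval
   [S_t, S_t + 1/n), and zeta_V <= 1 keeps all these disjoint intervals inside
   [0, 1).  Let C halt on p exactly when the dyadic interval of p is maximal among
   those contained in one claimed interval, and then output the result of the
   claiming computation.  Distinct maximal dyadic intervals are disjoint, so C is
   self-delimiting; those inside [S_t, S_t + 1/n) have total length 1/n, so
   Omega_C is the sum of the claims, zeta_V.  No allocation in the style of
   Kraft-Chaitin is needed.

   As 1/n > 2^-(|bin n| + 1), a claimed interval contains a dyadic interval of
   length at least 2^-(|bin n| + 2): passing from V to C costs two bits.  Every
   self-delimiting machine is a tuatara machine by Kraft's inequality, because
   1/n <= 2^-|bin n|; hence C is universal when V is.

   C is effective in V: it writes a self-delimiting copy of the code of V in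
   front of its input and runs a fixed machine, which simulates V and searches for
   the interval.  Both this machine and the one that computes the code of C come
   from a compiler of stack programs into Turing machines, together with closure
   of the functions computed by stack programs under pairing and iteration. *)

From Pilot Require Import Defs.
From HB Require Import structures.
From mathcomp Require Import all_boot all_order all_algebra.
From mathcomp Require Import all_classical all_reals all_analysis.
From mathcomp Require Import zify ring lra.
(* again, because mathcomp-analysis has its own [code] *)
Import Pilot.Defs.
Set Implicit Arguments.
Unset Strict Implicit.
Unset Printing Implicit Defensive.
Import Order.TTheory GRing.Theory Num.Theory.

(** * Stacks on the tape of a Turing machine *)

Definition upd {T} (f : nat -> T) (i : nat) (v : T) : nat -> T :=
  fun j => if j == i then v else f j.

Definition reach (M : machine) (c c' : config) : Prop :=
  exists n, iter n (obind (step M)) (Some c) = Some c'.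

(** At least one step, so that an endless chain of such runs is arbitrarily long; this is what
    divergence proofs need. *)
Definition reach1 (M : machine) (c c' : config) : Prop :=
  exists n, iter n.+1 (obind (step M)) (Some c) = Some c'.

Lemma reach_refl M c : reach M c c.
Proof. by exists 0. Qed.

Lemma reach_trans M c1 c2 c3 : reach M c1 c2 -> reach M c2 c3 -> reach M c1 c3.
Proof. by move=> [n Hn] [m Hm]; exists (m + n); rewrite iterD Hn Hm. Qed.

Lemma reach1_reach M c c' : reach1 M c c' -> reach M c c'.
Proof. by move=> [n Hn]; exists n.+1. Qed.

Lemma step_reach1 M c1 c2 c3 :
  step M c1 = Some c2 -> reach M c2 c3 -> reach1 M c1 c3.
Proof. by move=> H [n Hn]; exists n; rewrite iterSr /= H. Qed.

Lemma reach1_trans M c1 c2 c3 : reach1 M c1 c2 -> reach M c2 c3 -> reach1 M c1 c3.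
Proof.
by move=> [n Hn] [m Hm]; exists (m + n); rewrite -addnS iterD Hn Hm.
Qed.

Lemma step_reach M c1 c2 : step M c1 = Some c2 -> reach M c1 c2.
Proof. by move=> H; exists 1. Qed.

(* [on_tape c q h tau]: state [q], the head [h] cells to the right of cell [0]
   of the tape [tau]; what lies to the left of cell [0] is unconstrained. *)
Definition on_tape (c : config) (q h : nat) (tau : nat -> nat) : Prop :=
  [/\ cstate c = q, forall j, nth 0 (rtape c) j = tau (h + j) &
      forall j, j < h -> nth 0 (ltape c) j = tau (h - j.+1)].

Lemma on_tape_ext c q h tau tau' :
  tau =1 tau' -> on_tape c q h tau -> on_tape c q h tau'.
Proof.
by move=> E [Hq Hr Hl]; split=> // [j|j lt]; rewrite -E ?Hr ?Hl.
Qed.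

Lemma step_right M c q h tau q0 s0 q' w :
  on_tape c q h tau -> lookup M q (tau h) = Some (Instr q0 s0 q' w MoveR) ->
  exists c', step M c = Some c' /\ on_tape c' q' h.+1 (upd tau h w).
Proof.
case=> Hq Hr Hl Hlk; rewrite /step Hq -nth0 Hr addn0 Hlk /=.
eexists; split; first by [].
split=> //= [j|[_|j lt]] /=.
- by rewrite nth_behead Hr /upd addnS addSn; case: eqP => // ?; lia.
- by rewrite subn1 /upd /= eqxx.
- by rewrite Hl // /upd subSS; case: eqP => // ?; lia.
Qed.

Lemma step_left M c q h tau q0 s0 q' w :
  on_tape c q h.+1 tau ->
  lookup M q (tau h.+1) = Some (Instr q0 s0 q' w MoveL) ->
  exists c', step M c = Some c' /\ on_tape c' q' h (upd tau h.+1 w).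
Proof.
case=> Hq Hr Hl Hlk; rewrite /step Hq -nth0 Hr addn0 Hlk /=.
eexists; split; first by [].
split=> //= [[|[|j]]|j lt] /=.
- by rewrite -nth0 Hl // addn0 /upd subn1; case: eqP => // ?; lia.
- by rewrite addn1 /upd eqxx.
- by rewrite nth_behead Hr /upd addSn !addnS; case: eqP => // ?; lia.
- by rewrite nth_behead Hl // /upd subSS; case: eqP => // ?; lia.
Qed.

Definition table (Q S : nat) (f : nat -> nat -> nat * nat * move) : machine :=
  [seq (let r := f e.1 e.2 in Instr e.1 e.2 r.1.1 r.1.2 r.2)
     | e <- [seq (q, s) | q <- iota 0 Q, s <- iota 0 S]].

Lemma lookup_table Q S f q s : q < Q -> s < S ->
  lookup (table Q S f) q s =
  Some (Instr q s (f q s).1.1 (f q s).1.2 (f q s).2).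
Proof.
move=> ltq lts; rewrite /lookup /table filter_map.
rewrite (@eq_filter _ _ (pred1 (q, s))); last by case=> a b /=; rewrite xpair_eqE.
by rewrite filter_pred1_uniq ?allpairs_uniq ?iota_uniq //
  ?allpairs_f ?mem_iota // => -[? ?] [? ?].
Qed.

Lemma lookup_table_out Q S f q s : Q <= q -> lookup (table Q S f) q s = None.
Proof.
move=> leQ; rewrite /lookup /table filter_map.
rewrite (@eq_in_filter _ _ pred0) ?filter_pred0 //.
move=> _ /allpairsP[[a b] [/= Ha _ ->]] /=.
by move: Ha; rewrite mem_iota; case: eqP => // ->; lia.
Qed.

Fixpoint undigits (v : seq nat) : nat :=
  if v is a :: v' then a + 3 * undigits v' else 0.

Fixpoint cell_digits (k s : nat) : seq nat :=
  if k is k'.+1 then s %% 3 :: cell_digits k' (s %/ 3) else [::].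

Lemma undigitsK v : all (fun a => a < 3) v -> cell_digits (size v) (undigits v) = v.
Proof.
elim: v => //= a v IH /andP[lt3 /IH E].
by rewrite [3 * _]mulnC [a + _]addnC modnMDl modn_small // divnMDl // divn_small // addn0 E.
Qed.

Lemma undigits_lt v : all (fun a => a < 3) v -> undigits v < 3 ^ size v.
Proof. elim: v => //= a v IH /andP[lt3 /IH lt]; rewrite expnS; lia. Qed.

(** [INIT] plants the marker; the last argument of [PUSH] is its successor, and those of [POP] are
    the successors for an empty stack and for a popped [false] or [true]. *)
Inductive ir :=
  | INIT
  | PUSH (i : nat) (b : bool) (l : nat)
  | POP (i le l0 l1 : nat).

Definition stacks := nat -> seq bool.

Definition track (l : seq bool) (j : nat) : nat :=
  nth 0 [seq (nat_of_bool b).+1 | b <- rev l] j.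

Lemma track_lt l j : track l j < 3.
Proof.
rewrite /track; case: (ltnP j (size (rev l))) => H.
  by rewrite (nth_map false) //; case: nth.
by rewrite nth_default // size_map.
Qed.

Lemma track_eq0 l j : (track l j == 0) = (size l <= j).
Proof.
rewrite /track; case: (leqP (size l) j) => H.
  by rewrite nth_default // size_map size_rev.
by rewrite (nth_map false) ?size_rev.
Qed.

Lemma track_cons b l j :
  track (b :: l) j = if j == size l then b.+1 else track l j.
Proof.
rewrite /track rev_cons map_rcons nth_rcons size_map size_rev.
by case: (ltngtP j (size l)) => // H; rewrite nth_default // size_map size_rev ltnW.
Qed.

Section Simulation.
Variables (k : nat) (P : seq ir).

(* The stack [i] is written on the [i]-th track of the tape, bottom first, a
   cell being a number in base 3 whose [i]-th digit is the content of the track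
   ([0] when the stack is exhausted); the marker [3 ^ k] sits in cell [0]. *)
Definition stack_cells (s : stacks) (j : nat) : seq nat :=
  [seq track (s i) j | i <- iota 0 k].

Definition stack_tape (s : stacks) (j : nat) : nat :=
  if j is j'.+1 then undigits (stack_cells s j') else 3 ^ k.

(** State [4 * pc + p] is phase [p] of instruction [pc]. Phase 0 of [PUSH] and [POP] scans right to
    the first cell where track [i] is blank. In phase 1, [PUSH] returns to the marker, while [POP]
    inspects the cell on the left of the blank: the marker means an empty stack, and a digit 1 or 2
    is erased and sends the machine to phase 2 or 3, which remembers the bit on the way back. *)
Definition trans (q s : nat) : nat * nat * move :=
  let d := cell_digits k s in
  match nth INIT P (q %/ 4), q %% 4 with
  | INIT, 0 => (q.+1, s, MoveL)
  | INIT, _ => (4 * (q %/ 4).+1, 3 ^ k, MoveR)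
  | PUSH i b l, 0 =>
      if nth 0 d i == 0 then (q.+1, undigits (set_nth 0 d i b.+1), MoveL)
      else (q, s, MoveR)
  | PUSH i b l, _ => if s == 3 ^ k then (4 * l, s, MoveR) else (q, s, MoveL)
  | POP i le l0 l1, 0 =>
      if nth 0 d i == 0 then (q.+1, s, MoveL) else (q, s, MoveR)
  | POP i le l0 l1, 1 =>
      if s == 3 ^ k then (4 * le, s, MoveR)
      else (q + nth 0 d i, undigits (set_nth 0 d i 0), MoveL)
  | POP i le l0 l1, p =>
      if s == 3 ^ k then (4 * (if p == 2 then l0 else l1), s, MoveR)
      else (q, s, MoveL)
  end.

(** One more symbol than [3 ^ k] makes room for the marker. Address [size P] has no instruction, so
    a jump there halts. *)
Definition tm : machine := table (4 * size P) (3 ^ k).+1 trans.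

Lemma lookup_tm q s : q < 4 * size P -> s <= 3 ^ k ->
  lookup tm q s =
  Some (Instr q s (trans q s).1.1 (trans q s).1.2 (trans q s).2).
Proof. by move=> ltq les; rewrite /tm lookup_table. Qed.

Lemma tm_right c q h tau q' w :
  q < 4 * size P -> tau h <= 3 ^ k -> trans q (tau h) = (q', w, MoveR) ->
  on_tape c q h tau ->
  exists c', step tm c = Some c' /\ on_tape c' q' h.+1 (upd tau h w).
Proof.
move=> ltq le E Hc; apply: (step_right (q0 := q) (s0 := tau h) Hc).
by rewrite lookup_tm // E.
Qed.

Lemma tm_left c q h tau q' w :
  q < 4 * size P -> tau h.+1 <= 3 ^ k -> trans q (tau h.+1) = (q', w, MoveL) ->
  on_tape c q h.+1 tau ->
  exists c', step tm c = Some c' /\ on_tape c' q' h (upd tau h.+1 w).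
Proof.
move=> ltq le E Hc; apply: (step_left (q0 := q) (s0 := tau h.+1) Hc).
by rewrite lookup_tm // E.
Qed.

Lemma stack_cells_lt3 s j : all (fun a => a < 3) (stack_cells s j).
Proof. by apply/allP => _ /mapP[i _ ->]; apply: track_lt. Qed.

Lemma cell_digitsE s j : cell_digits k (stack_tape s j.+1) = stack_cells s j.
Proof.
by rewrite /= -[X in cell_digits X](size_iota 0 k) -(size_map (fun i => track (s i) j))
  undigitsK ?stack_cells_lt3.
Qed.

Lemma stack_tape_lt s j : stack_tape s j.+1 < 3 ^ k.
Proof.
by have := undigits_lt (stack_cells_lt3 s j); rewrite size_map size_iota.
Qed.

Lemma stack_tape_le s j : stack_tape s j <= 3 ^ k.
Proof. by case: j => // j; apply/ltnW/stack_tape_lt. Qed.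

Lemma nth_stack_cells s i j : i < k -> nth 0 (stack_cells s j) i = track (s i) j.
Proof. by move=> lti; rewrite (nth_map 0) ?size_iota // nth_iota. Qed.

Lemma upd_tape_id (tau : nat -> nat) h : upd tau h (tau h) =1 tau.
Proof. by move=> j; rewrite /upd; case: eqP => [->|]. Qed.

Lemma sweep_right c q h s m : q < 4 * size P ->
  (forall j, j < m -> trans q (stack_tape s (h + j)) =
     (q, stack_tape s (h + j), MoveR)) ->
  on_tape c q h (stack_tape s) ->
  exists2 c', reach tm c c' & on_tape c' q (h + m) (stack_tape s).
Proof.
move=> ltq; elim: m c h => [|m IH] c h H Hc.
  by rewrite addn0; exists c => //; apply: reach_refl.
have H0 := H 0 isT; rewrite addn0 in H0.
have [c1 [Hs /(on_tape_ext (upd_tape_id _ _)) Hc1]] :=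
  tm_right ltq (stack_tape_le _ _) H0 Hc.
have [j lt|c2 R2 Hc2] := IH c1 h.+1 _ Hc1; first by rewrite addSnnS H.
exists c2; last by rewrite -addSnnS.
exact: reach_trans (step_reach Hs) R2.
Qed.

Lemma return_left c q h s l : q < 4 * size P ->
  (forall j, trans q (stack_tape s j.+1) = (q, stack_tape s j.+1, MoveL)) ->
  trans q (3 ^ k) = (4 * l, 3 ^ k, MoveR) ->
  on_tape c q h (stack_tape s) ->
  exists2 c', reach tm c c' & on_tape c' (4 * l) 1 (stack_tape s).
Proof.
move=> ltq HL H0; elim: h c => [|h IH] c Hc.
  have [c1 [Hs /(on_tape_ext (upd_tape_id _ _)) Hc1]] :=
    tm_right ltq (stack_tape_le s 0) H0 Hc.
  by exists c1 => //; apply: step_reach.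
have [c1 [Hs /(on_tape_ext (upd_tape_id _ _)) /IH [c2 R2 Hc2]]] :=
  tm_left ltq (stack_tape_le _ _) (HL _) Hc.
by exists c2 => //; apply: reach_trans (step_reach Hs) R2.
Qed.

Lemma trans_state q p : p < 4 -> ((4 * q + p) %/ 4 = q) * ((4 * q + p) %% 4 = p).
Proof. by move=> lt; split; lia. Qed.

(** Between two instructions the head rests on cell 1, just right of the marker. *)
Definition at_pc (c : config) (pc : nat) (s : stacks) : Prop :=
  on_tape c (4 * pc) 1 (stack_tape s).

Definition goes (pc : nat) (s : stacks) (pc' : nat) (s' : stacks) : Prop :=
  forall c, at_pc c pc s -> exists2 c', reach1 tm c c' & at_pc c' pc' s'.

Lemma goes_trans pc1 s1 pc2 s2 pc3 s3 :
  goes pc1 s1 pc2 s2 -> goes pc2 s2 pc3 s3 -> goes pc1 s1 pc3 s3.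
Proof.
move=> H1 H2 c /H1 [c1 R1 /H2 [c2 R2 H]]; exists c2 => //.
exact: reach1_trans R1 (reach1_reach R2).
Qed.

(** Push and pop both change a single digit of a single cell: [v] is [b.+1] for a push and [0] for a
    pop. *)
Lemma stack_tape_upd s i l j v : i < k ->
  (forall j', track l j' = if j' == j then v else track (s i) j') ->
  upd (stack_tape s) j.+1 (undigits (set_nth 0 (stack_cells s j) i v))
  =1 stack_tape (upd s i l).
Proof.
move=> lti H [|j'] //; rewrite /upd /= eqSS; case: eqP => [->|ne]; congr undigits.
  apply: (@eq_from_nth _ 0) => [|i']; rewrite size_set_nth !size_map size_iota.
    by apply/maxn_idPr.
  move=> lt'; have {}lt' : i' < k by move: lt'; rewrite (maxn_idPr _).
  rewrite nth_set_nth /= !(nth_map 0) ?size_iota // !nth_iota //= add0n /upd.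
  by case: eqP => // _; rewrite H eqxx.
apply/eq_in_map => i' _; rewrite /upd; case: eqP => // ->.
by rewrite H; case: eqP.
Qed.

Lemma goes_push pc s i b l : pc < size P -> nth INIT P pc = PUSH i b l -> i < k ->
  goes pc s l (upd s i (b :: s i)).
Proof.
move=> ltpc EP lti c Hc.
have ltq p : p < 4 -> 4 * pc + p < 4 * size P by lia.
rewrite /at_pc -[4 * pc]addn0 in Hc.
have [j|c1 R1 Hc1] := sweep_right (m := size (s i)) (ltq 0 isT) _ Hc.
  move=> ltj; rewrite /trans !trans_state // EP add1n cell_digitsE.
  by rewrite nth_stack_cells // track_eq0 leqNgt ltj.
have E0 : trans (4 * pc + 0) (stack_tape s (size (s i)).+1) =
    ((4 * pc + 0).+1, undigits (set_nth 0 (stack_cells s (size (s i))) i b.+1), MoveL).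
  rewrite /trans !trans_state // EP cell_digitsE.
  by rewrite nth_stack_cells // track_eq0 leqnn.
have [c2 [S2 T2]] := tm_left (ltq 0 isT) (stack_tape_le _ _) E0 Hc1.
have Hc2 := on_tape_ext (stack_tape_upd lti (track_cons b (s i))) T2.
have EL j : trans (4 * pc + 1) (stack_tape (upd s i (b :: s i)) j.+1) =
    (4 * pc + 1, stack_tape (upd s i (b :: s i)) j.+1, MoveL).
  by rewrite /trans !trans_state // EP ltn_eqF ?stack_tape_lt.
have EM : trans (4 * pc + 1) (3 ^ k) = (4 * l, 3 ^ k, MoveR).
  by rewrite /trans !trans_state // EP eqxx.
rewrite addn0 -addn1 in Hc2.
have [c3 R3 Hc3] := return_left (ltq 1 isT) EL EM Hc2.
exists c3 => //; case: R1 => n Hn; case: R3 => m Hm.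
by exists (m + n); rewrite -addnS iterD iterS Hn /= S2.
Qed.

Lemma goes_pop_nil pc s i le l0 l1 :
  pc < size P -> nth INIT P pc = POP i le l0 l1 -> i < k ->
  s i = [::] -> goes pc s le s.
Proof.
move=> ltpc EP lti si0 c Hc; rewrite /at_pc -[4 * pc]addn0 in Hc.
have ltq p : p < 4 -> 4 * pc + p < 4 * size P by lia.
have E0 : trans (4 * pc + 0) (stack_tape s 1) =
    ((4 * pc + 0).+1, stack_tape s 1, MoveL).
  by rewrite /trans !trans_state // EP cell_digitsE nth_stack_cells // si0.
have [c1 [S1 /(on_tape_ext (upd_tape_id _ _)) Hc1]] :=
  tm_left (ltq 0 isT) (stack_tape_le _ _) E0 Hc.
rewrite addn0 -addn1 in Hc1.
have E1 : trans (4 * pc + 1) (stack_tape s 0) = (4 * le, stack_tape s 0, MoveR).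
  by rewrite /trans !trans_state // EP eqxx.
have [c2 [S2 /(on_tape_ext (upd_tape_id _ _)) Hc2]] :=
  tm_right (ltq 1 isT) (stack_tape_le _ _) E1 Hc1.
by exists c2 => //; apply: step_reach1 S1 (step_reach S2).
Qed.

Lemma goes_pop_cons pc s i le l0 l1 b t :
  pc < size P -> nth INIT P pc = POP i le l0 l1 -> i < k ->
  s i = b :: t -> goes pc s (if b then l1 else l0) (upd s i t).
Proof.
move=> ltpc EP lti si c Hc; rewrite /at_pc -[4 * pc]addn0 in Hc.
have ltq p : p < 4 -> 4 * pc + p < 4 * size P by lia.
have [j|c1 R1 Hc1] := sweep_right (m := size (s i)) (ltq 0 isT) _ Hc.
  move=> ltj; rewrite /trans !trans_state // EP add1n cell_digitsE.
  by rewrite nth_stack_cells // track_eq0 leqNgt ltj.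
have E0 : trans (4 * pc + 0) (stack_tape s (size (s i)).+1) =
    ((4 * pc + 0).+1, stack_tape s (size (s i)).+1, MoveL).
  rewrite /trans !trans_state // EP cell_digitsE.
  by rewrite nth_stack_cells // track_eq0 leqnn.
have [c2 [S2 T2]] := tm_left (ltq 0 isT) (stack_tape_le _ _) E0 Hc1.
have Hc2 := on_tape_ext (upd_tape_id _ _) T2.
(* The top bit lies in cell [size (s i)], one to the left of the first blank, where the head now
   stands. *)
have Es : size (s i) = (size t).+1 by rewrite si.
rewrite addn0 -addn1 Es in Hc2.
have E1 : trans (4 * pc + 1) (stack_tape s (size t).+1) =
    (4 * pc + (1 + b.+1), undigits (set_nth 0 (stack_cells s (size t)) i 0), MoveL).
  rewrite /trans !trans_state // EP ltn_eqF ?stack_tape_lt // cell_digitsE.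
  by rewrite nth_stack_cells // si track_cons eqxx -addnA.
have [c3 [S3]] := tm_left (ltq 1 isT) (stack_tape_le _ _) E1 Hc2.
have /(stack_tape_upd lti) Eu : forall j, track t j =
    if j == size t then 0 else track (s i) j.
  move=> j; rewrite si track_cons; case: eqP => // ->.
  by apply/eqP; rewrite track_eq0.
move=> /(on_tape_ext Eu) Hc3.
have lt4 : 1 + b.+1 < 4 by case: (b).
have EL j : trans (4 * pc + (1 + b.+1)) (stack_tape (upd s i t) j.+1) =
    (4 * pc + (1 + b.+1), stack_tape (upd s i t) j.+1, MoveL).
  rewrite /trans !(trans_state _ lt4) EP.
  by case: (b); rewrite add1n ltn_eqF ?stack_tape_lt.
have EM : trans (4 * pc + (1 + b.+1)) (3 ^ k) =
    (4 * (if b then l1 else l0), 3 ^ k, MoveR).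
  rewrite /trans !(trans_state _ lt4) EP.
  by case: (b); rewrite add1n eqxx.
have [c4 R4 Hc4] := return_left (ltq _ lt4) EL EM Hc3.
exists c4 => //; case: R1 => n Hn; case: R4 => m Hm.
by exists (m + (n + 1)); rewrite -!addnS iterD addn2 !iterS Hn /= S2 /= S3.
Qed.

(** The first digit of the input is leftmost on the tape, hence at the bottom of stack 0; this is
    the reason for [rev]. *)
Definition input_stacks (x : seq bool) : stacks :=
  fun i => if i is 0 then rev x else [::].

Lemma undigits0 (I : Type) (r : seq I) : undigits [seq 0 | i <- r] = 0.
Proof. by elim: r => //= _ r ->. Qed.

(** A base 3 cell whose digits above the lowest vanish equals that lowest digit, so stack 0 alone is
    written exactly as an ordinary binary word. Input and output therefore need no conversion of
    symbols. *)
Lemma stack_tape_only0 s j : 0 < k -> (forall i, 0 < i -> s i = [::]) ->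
  stack_tape s j.+1 = track (s 0) j.
Proof.
rewrite /stack_tape /stack_cells; case: (k) => // k' _ H.
rewrite [iota _ _]/= [map _ _]/= [undigits _]/=.
suff -> : [seq track (s i) j | i <- iota 1 k'] = [seq 0 | i <- iota 1 k'].
  by rewrite undigits0 muln0 addn0.
apply/eq_in_map => i.
by rewrite mem_iota => /andP[/H -> _]; apply/eqP; rewrite track_eq0.
Qed.

Lemma start_tm x : 0 < k -> 0 < size P -> nth INIT P 0 = INIT ->
  exists2 c, reach tm (init x) c & at_pc c 1 (input_stacks x).
Proof.
move=> k0 P0 E0; pose s := input_stacks x; pose t0 := upd (stack_tape s) 0 0.
have only0 j : stack_tape s j.+1 = track (rev x) j by rewrite stack_tape_only0 // => -[].
have t0E j : t0 j.+1 = stack_tape s j.+1 by [].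
have Hi : on_tape (init x) 0 1 t0.
  split=> //= [j|[]] //.
  by rewrite add1n t0E only0 /track revK.
have T1 : trans 0 (t0 1) = (1, t0 1, MoveL) by rewrite /trans E0.
have [||c1 [S1 H1]] := tm_left _ _ T1 Hi; [lia|by rewrite t0E stack_tape_le|].
have T2 : trans 1 (upd t0 1 (t0 1) 0) = (4 * 1, 3 ^ k, MoveR) by rewrite /trans E0.
have [||c2 [S2 H2]] := tm_right _ _ T2 H1; [lia|by []|].
exists c2; first exact: reach_trans (step_reach S1) (step_reach S2).
by apply: on_tape_ext H2 => -[|[|j]].
Qed.

Lemma digits_map t y : (forall j, nth 0 t j = nth 0 [seq (nat_of_bool b).+1 | b <- y] j) ->
  digits t = y.
Proof.
elim: y t => [|b y IH] [|a t] H //=.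
- by have := H 0 => /= ->.
- by have := H 0.
- by have := H 0 => /= ->; case: b H => H; rewrite (IH t) // => j; apply: (H j.+1).
Qed.

Lemma halt_tm c s : 0 < k -> at_pc c (size P) s -> (forall i, 0 < i -> s i = [::]) ->
  step tm c = None /\ digits (rtape c) = rev (s 0).
Proof.
move=> k0 [Hq Hr _] only0; split; first by rewrite /step Hq lookup_table_out.
by apply: digits_map => j; rewrite Hr add1n stack_tape_only0.
Qed.

(** Each [goes] takes at least one step, so [n] of them survive [n] steps; a machine that had halted
    would stay at [None]. *)
Lemma goes_loop_forever (X : nat -> nat * stacks) c :
  (forall n, goes (X n).1 (X n).2 (X n.+1).1 (X n.+1).2) ->
  at_pc c (X 0).1 (X 0).2 ->
  forall n, iter n (obind (step tm)) (Some c) <> None.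
Proof.
move=> HX H0 n.
have [m [c' [le Hm _]]] : exists m c', [/\ n <= m,
    iter m (obind (step tm)) (Some c) = Some c' & at_pc c' (X n).1 (X n).2].
  elim: n => [|n [m [c' [le Hm /HX [c2 [m2 Hm2] H2]]]]]; first by exists 0, c.
  by exists (m2.+1 + m), c2; split=> //; [lia|rewrite iterD Hm].
have noneS j : iter j (obind (step tm)) None = None by elim: j => //= j ->.
by move=> Hn; move: Hm; rewrite -(subnK le) iterD Hn noneS.
Qed.

End Simulation.

(** * Stack programs *)

Inductive cmd :=
  | Push (i : nat) (b : bool)
  | Seq (c1 c2 : cmd)
  | Loop (i : nat) (c0 c1 : cmd)
  | Case (i : nat) (ce cn : cmd).

Inductive bs : cmd -> stacks -> stacks -> Prop :=
  | bs_push i b s : bs (Push i b) s (upd s i (b :: s i))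
  | bs_seq c1 c2 s1 s2 s3 : bs c1 s1 s2 -> bs c2 s2 s3 -> bs (Seq c1 c2) s1 s3
  | bs_loop_nil i c0 c1 s : s i = [::] -> bs (Loop i c0 c1) s s
  | bs_loop_cons i c0 c1 s b l s' s'' : s i = b :: l ->
      bs (if b then c1 else c0) (upd s i l) s' -> bs (Loop i c0 c1) s' s'' ->
      bs (Loop i c0 c1) s s''
  | bs_case_nil i ce cn s s' : s i = [::] -> bs ce s s' -> bs (Case i ce cn) s s'
  | bs_case_cons i ce cn s b l s' : s i = b :: l -> bs cn (upd s i l) s' ->
      bs (Case i ce cn) s s'.

Fixpoint regs (c : cmd) : nat :=
  match c with
  | Push i _ => i.+1
  | Seq c1 c2 => maxn (regs c1) (regs c2)
  | Loop i c1 c2 | Case i c1 c2 => maxn i.+1 (maxn (regs c1) (regs c2))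
  end.

Fixpoint clen (c : cmd) : nat :=
  match c with
  | Push _ _ => 1
  | Seq c1 c2 => clen c1 + clen c2
  | Loop _ c1 c2 | Case _ c1 c2 => (clen c1 + clen c2).+1
  end.

(* code of [c] placed at address [o] and continuing at address [e]; there is no
   jump instruction since every instruction names its successors *)
Fixpoint compile (o e : nat) (c : cmd) : seq ir :=
  match c with
  | Push i b => [:: PUSH i b e]
  | Seq c1 c2 => compile o (o + clen c1) c1 ++ compile (o + clen c1) e c2
  | Loop i c0 c1 => POP i e o.+1 (o.+1 + clen c0) ::
      compile o.+1 o c0 ++ compile (o.+1 + clen c0) o c1
  | Case i ce cn => POP i o.+1 (o.+1 + clen ce) (o.+1 + clen ce) ::
      compile o.+1 e ce ++ compile (o.+1 + clen ce) e cn
  end.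

Lemma size_compile o e c : size (compile o e c) = clen c.
Proof.
elim: c o e => //= [c1 IH1 c2 IH2|i c1 IH1 c2 IH2|i c1 IH1 c2 IH2] o e;
  by rewrite size_cat IH1 IH2.
Qed.

Definition code_at (P : seq ir) (o : nat) (L : seq ir) : Prop :=
  forall j, j < size L -> o + j < size P /\ nth INIT P (o + j) = nth INIT L j.

Lemma code_at_cat P o L1 L2 : code_at P o (L1 ++ L2) ->
  code_at P o L1 /\ code_at P (o + size L1) L2.
Proof.
move=> H; split=> j lt.
  have [|] := H j; first by rewrite size_cat; lia.
  by rewrite nth_cat lt.
have [|] := H (size L1 + j); first by rewrite size_cat ltn_add2l.
by rewrite addnA nth_cat ifN ?addKn // -leqNgt leq_addr.
Qed.

Lemma code_at_cons P o a L : code_at P o (a :: L) ->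
  [/\ o < size P, nth INIT P o = a & code_at P o.+1 L].
Proof.
move=> H; have [] := H 0 isT; rewrite addn0 => lt E; split=> // j ltj.
by have := H j.+1 ltj; rewrite addnS.
Qed.

Lemma code_at_seq P o e c1 c2 : code_at P o (compile o e (Seq c1 c2)) ->
  code_at P o (compile o (o + clen c1) c1) /\
  code_at P (o + clen c1) (compile (o + clen c1) e c2).
Proof. by move=> /code_at_cat[]; rewrite size_compile. Qed.

Lemma code_at_loop P o e i c0 c1 : code_at P o (compile o e (Loop i c0 c1)) ->
  [/\ o < size P, nth INIT P o = POP i e o.+1 (o.+1 + clen c0),
      code_at P o.+1 (compile o.+1 o c0) &
      code_at P (o.+1 + clen c0) (compile (o.+1 + clen c0) o c1)].
Proof. by move=> /code_at_cons[lt E /code_at_cat[]]; rewrite size_compile. Qed.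

Lemma compile_correct k P c s s' : bs c s s' -> regs c <= k ->
  forall o e, code_at P o (compile o e c) -> goes k P o s e s'.
Proof.
elim=> {c s s'} [i b s|c1 c2 s1 s2 s3 _ IH1 _ IH2|i c0 c1 s si|
    i c0 c1 s b l s' s'' si _ IH1 _ IH2|i ce cn s s' si _ IH|
    i ce cn s b l s' si _ IH] /=; rewrite ?geq_max => R o e.
- by move=> /code_at_cons[lt E _]; apply: goes_push lt E R.
- case/andP: R => R1 R2 /code_at_seq[/IH1 H1 /IH2 H2].
  exact: goes_trans (H1 R1) (H2 R2).
- by case/andP: R => Ri _ /code_at_loop[lt E _ _]; apply: goes_pop_nil lt E Ri si.
- move=> Hc; have [lt E Hc0 Hc1] := code_at_loop Hc.
  case/and3P: (R) => Ri R0 R1.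
  apply: goes_trans (goes_pop_cons lt E Ri si) _.
  (* The body exits to the address [o] of the loop itself, so the remaining rounds run on the same
     code. *)
  apply: goes_trans (IH2 _ _ _ Hc); last by rewrite !geq_max.
  by apply: IH1; case: (b).
- case/and3P: R => Ri Re _ /code_at_cons[lt E /code_at_cat[He _]].
  exact: goes_trans (goes_pop_nil lt E Ri si) (IH Re _ _ He).
- case/and3P: R => Ri _ Rn /code_at_cons[lt E /code_at_cat[_]].
  rewrite size_compile => Hn.
  apply: goes_trans (goes_pop_cons lt E Ri si) _.
  by rewrite if_same; apply: IH.
Qed.

(** From [d] on, the stacks are registers holding the numbers of [l] in unary, and [0] beyond [l];
    those below [d] are arbitrary and stay out of reach of a program based at [d]. *)
Definition frame (rho : stacks) (d : nat) (l : seq nat) : stacks :=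
  fun j => if j < d then rho j else nseq (nth 0 l (j - d)) true.

Lemma frame_reg rho d l i : frame rho d l (d + i) = nseq (nth 0 l i) true.
Proof. by rewrite /frame ltnNge leq_addr /= addKn. Qed.

Lemma upd_frame rho d l i m :
  upd (frame rho d l) (d + i) (nseq m true) = frame rho d (set_nth 0 l i m).
Proof.
apply: funext => j; rewrite /upd /frame; case: eqP => [->|ne].
  by rewrite ltnNge leq_addr /= addKn nth_set_nth /= eqxx.
case: ltnP => // le; rewrite nth_set_nth /=; case: eqP => // E; lia.
Qed.

Lemma eq_frame rho d l l' : nth 0 l =1 nth 0 l' -> frame rho d l = frame rho d l'.
Proof. by move=> E; apply: funext => j; rewrite /frame E. Qed.

Lemma frame_cat rho d l l' :
  frame rho d (l ++ l') = frame (frame rho d l) (d + size l) l'.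
Proof.
apply: funext => j; rewrite /frame nth_cat; case: (ltnP j d) => [lt|le].
  by rewrite ltn_addr.
rewrite (_ : (j < d + size l) = (j - d < size l)); last lia.
by case: ltnP => // le'; rewrite subnDA.
Qed.

Lemma bs_inc rho d l i :
  bs (Push (d + i) true) (frame rho d l) (frame rho d (set_nth 0 l i (nth 0 l i).+1)).
Proof. by rewrite -upd_frame; have := bs_push (d + i) true (frame rho d l); rewrite frame_reg. Qed.

Definition rep (i : nat) (c : cmd) : cmd := Loop i c c.

(** [L m] is the loop invariant, the list of registers when the counter [i] holds [m]. The loop has
    already decremented the counter when the body starts, hence the [set_nth]. *)
Lemma bs_rep_frame (L : nat -> seq nat) rho d i c n :
  (forall m, m <= n -> nth 0 (L m) i = m) ->
  (forall m, m < n ->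
     bs c (frame rho d (set_nth 0 (L m.+1) i m)) (frame rho d (L m))) ->
  bs (rep (d + i) c) (frame rho d (L n)) (frame rho d (L 0)).
Proof.
elim: n => [|n IH] HL Hc; first by apply: bs_loop_nil; rewrite frame_reg HL.
apply: bs_loop_cons (IH _ _); last 2 first.
- by move=> m le; apply: HL; apply: leqW.
- by move=> m lt; apply: Hc; apply: leqW.
- by rewrite frame_reg HL.
- have := Hc n (leqnn _); rewrite -upd_frame; exact.
Qed.

(** * Functions computed by stack programs *)

(* A program computes [f] in place if it replaces the number [x] in any chosen
   register [d] by [f x], using as scratch the registers above [d], which are
   empty before and after. *)
Definition ncomp (f : nat -> nat) : Prop := forall d, exists c, forall rho x,
  bs c (frame rho d [:: x]) (frame rho d [:: f x]).

Lemma bs_ext c s s1 s2 : s1 = s2 -> bs c s s1 -> bs c s s2.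
Proof. by move=> <-. Qed.

Lemma ncomp_ext f g : f =1 g -> ncomp f -> ncomp g.
Proof. by move=> E H d; have [c Hc] := H d; exists c => rho x; rewrite -E. Qed.

Definition mv d i j := rep (d + i) (Push (d + j) true).

Lemma bs_mv rho d i j l : i <> j ->
  bs (mv d i j) (frame rho d l)
     (frame rho d (set_nth 0 (set_nth 0 l j (nth 0 l i + nth 0 l j)) i 0)).
Proof.
move=> ne; pose n := nth 0 l i.
pose L m := set_nth 0 (set_nth 0 l j (n - m + nth 0 l j)) i m.
have -> : frame rho d l = frame rho d (L n).
  apply: eq_frame => p; rewrite /L !nth_set_nth /= nth_set_nth /= subnn.
  by case: eqP => [->|] //; case: eqP => [->|].
have -> : set_nth 0 (set_nth 0 l j (nth 0 l i + nth 0 l j)) i 0 = L 0.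
  by rewrite /L subn0.
apply: bs_rep_frame => m lt; first by rewrite /L nth_set_nth /= eqxx.
apply: bs_ext (bs_inc _ _ _ _); apply: eq_frame => p.
rewrite /L /=; do 8 rewrite ?nth_set_nth /=.
rewrite (introF eqP (fun E : j = i => ne (esym E))) !eqxx.
case: (p =P j) => [->|_]; last by case: (p =P i).
rewrite (introF eqP (fun E : j = i => ne (esym E))); lia.
Qed.

Ltac frame_eq :=
  apply: eq_frame => -[|[|[|[|[|?]]]]] //=; rewrite ?nth_nil //.

Lemma bs_copy d : exists c, forall rho x,
  bs c (frame rho d [:: x]) (frame rho d [:: x; x]).
Proof.
exists (Seq (rep (d + 0) (Seq (Push (d + 1) true) (Push (d + 2) true))) (mv d 2 0)).
move=> rho x; apply: (@bs_seq _ _ _ (frame rho d [:: 0; x; x])).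
  pose L m := [:: m; x - m; x - m].
  have -> : frame rho d [:: x] = frame rho d (L x) by rewrite /L subnn; frame_eq.
  have -> : [:: 0; x; x] = L 0 by rewrite /L subn0.
  apply: bs_rep_frame => // m lt.
  apply: bs_seq (bs_inc _ _ _ _) (bs_ext _ (bs_inc _ _ _ _)).
  by rewrite /= subnSK.
by apply: bs_ext (bs_mv _ _ _ _) => //=; rewrite addn0; frame_eq.
Qed.

(** Since register [t] is empty, [mv d t t] does nothing and serves as the missing skip command. *)
Lemma bs_clear rho d i t l : i <> t -> nth 0 l t = 0 ->
  bs (rep (d + i) (mv d t t)) (frame rho d l) (frame rho d (set_nth 0 l i 0)).
Proof.
move=> ne l0; pose L m := set_nth 0 l i m.
have -> : frame rho d l = frame rho d (L (nth 0 l i)).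
  by apply: eq_frame => j; rewrite nth_set_nth /=; case: eqP => [->|].
apply: bs_rep_frame => m lt; first by rewrite nth_set_nth /= eqxx.
rewrite set_set_nth eqxx; apply: bs_loop_nil.
by rewrite frame_reg nth_set_nth /=; case: eqP => [E|_]; [case: ne | rewrite l0].
Qed.

Lemma bs_case0 rho d l i ce cn s : nth 0 l i = 0 ->
  bs ce (frame rho d l) s -> bs (Case (d + i) ce cn) (frame rho d l) s.
Proof. by move=> l0; apply: bs_case_nil; rewrite frame_reg l0. Qed.

Lemma bs_caseS rho d l i ce cn s m : nth 0 l i = m.+1 ->
  bs cn (frame rho d (set_nth 0 l i m)) s -> bs (Case (d + i) ce cn) (frame rho d l) s.
Proof.
by move=> lS; rewrite -upd_frame; apply: bs_case_cons; rewrite frame_reg lS.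
Qed.

(** The registers of [l] become part of the protected stacks when the base is raised to
    [d + size l]. *)
Lemma bs_above rho d l c f x :
  (forall rho y, bs c (frame rho (d + size l) [:: y]) (frame rho (d + size l) [:: f y])) ->
  bs c (frame rho d (l ++ [:: x])) (frame rho d (l ++ [:: f x])).
Proof. by move=> H; rewrite !frame_cat. Qed.

(** The triangular number [0 + 1 + ... + n]. *)
Definition tri (n : nat) : nat := 'C(n.+1, 2).

Lemma triS n : tri n.+1 = tri n + n.+1.
Proof. by rewrite /tri binS bin1. Qed.

Lemma leq_tri m n : m <= n -> tri m <= tri n.
Proof. by move=> le; apply: leq_bin2l. Qed.

(* Cantor's pairing; [unpair] inverts it by walking along the antidiagonals, a
   loop that needs neither division nor square roots. *)
Definition pair_nat (a b : nat) : nat := tri (a + b) + b.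

Definition next_pair (p : nat * nat) : nat * nat :=
  if p.1 is a.+1 then (a, p.2.+1) else (p.2.+1, 0).

Definition unpair (z : nat) : nat * nat := iter z next_pair (0, 0).

Lemma iter_next_pair a b c : iter b next_pair (a + b, c) = (a, b + c).
Proof. by elim: b c => [|b IH] c; rewrite ?addn0 // addnS iterSr IH addnS. Qed.

Lemma pair_natK a b : unpair (pair_nat a b) = (a, b).
Proof.
rewrite /unpair /pair_nat addnC iterD.
suff -> n : iter (tri n) next_pair (0, 0) = (n, 0) by rewrite iter_next_pair addn0.
elim: n => // n IH; rewrite triS addnC iterD IH iterS.
by rewrite -[X in (X, 0)]add0n iter_next_pair addn0.
Qed.

Lemma unpairK z : pair_nat (unpair z).1 (unpair z).2 = z.
Proof.
elim: z => // z IH; rewrite /unpair iterS -/(unpair z) -[in RHS]IH.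
case: (unpair z) => [[|a] b] /=; rewrite /pair_nat.
  by rewrite !addn0 add0n triS addnS.
by rewrite addnS addSn addnS.
Qed.

Lemma bs_unpair d : exists c, forall rho z,
  bs c (frame rho d [:: z]) (frame rho d [:: 0; (unpair z).1; (unpair z).2]).
Proof.
(* The body performs [next_pair] on registers 1 and 2; its case distinction also decrements a
   nonzero first component. *)
exists (rep (d + 0) (Case (d + 1) (Seq (mv d 2 1) (Push (d + 1) true))
  (Push (d + 2) true))) => rho z.
pose L m := [:: m; (unpair (z - m)).1; (unpair (z - m)).2].
have -> : frame rho d [:: z] = frame rho d (L z) by rewrite /L subnn; frame_eq.
rewrite -[in X in bs _ _ (frame _ _ X)](subn0 z) -/(L 0).
apply: bs_rep_frame => // m lt; rewrite /L -(subnSK lt) /unpair iterS -/(unpair _).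
case: (unpair (z - m.+1)) => [[|a] b] /=.
  apply: bs_case0 => //; apply: bs_seq (bs_mv _ _ _ _) _ => //=.
  by apply: bs_ext (bs_inc _ _ _ _); rewrite /= addn0.
apply: (@bs_caseS _ _ _ _ _ _ _ a) => //=.
by apply: bs_ext (bs_inc _ _ _ _).
Qed.

Lemma bs_pair d : exists c, forall rho a b,
  bs c (frame rho d [:: a; b]) (frame rho d [:: pair_nat a b]).
Proof.
(* [c1] forms [a + b] in register 0 and saves [b] in register 2. A round of [c2] whose counter drops
   to [m] adds [m + 1] to register 2, so [c2] adds [tri (a + b)] in all; register 1 holds the
   counter while it is being copied. *)
pose c1 := rep (d + 1) (Seq (Push (d + 0) true) (Push (d + 2) true)).
pose c2 := rep (d + 0) (Seq (rep (d + 0) (Seq (Push (d + 1) true) (Push (d + 2) true)))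
  (Seq (mv d 1 0) (Push (d + 2) true))).
exists (Seq c1 (Seq c2 (mv d 2 0))) => rho a b.
apply: (@bs_seq _ _ _ (frame rho d [:: a + b; 0; b])).
  pose L m := [:: a + (b - m); m; b - m].
  have -> : frame rho d [:: a; b] = frame rho d (L b) by rewrite /L subnn addn0; frame_eq.
  have -> : [:: a + b; 0; b] = L 0 by rewrite /L subn0.
  apply: bs_rep_frame => // m lt.
  apply: bs_seq (bs_inc _ _ _ _) (bs_ext _ (bs_inc _ _ _ _)).
  by rewrite /= -addnS subnSK.
apply: (@bs_seq _ _ _ (frame rho d [:: 0; 0; pair_nat a b])).
  set s := a + b; pose L m := [:: m; 0; tri s - tri m + b].
  have -> : frame rho d [:: s; 0; b] = frame rho d (L s) by rewrite /L subnn.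
  have -> : [:: 0; 0; pair_nat a b] = L 0 by rewrite /L subn0.
  apply: bs_rep_frame => // m lt /=.
  set z := tri s - tri m.+1 + b.
  apply: (@bs_seq _ _ _ (frame rho d [:: 0; m; z + m])).
    pose L' j := [:: j; m - j; z + (m - j)].
    have -> : [:: m; 0; z] = L' m by rewrite /L' subnn addn0.
    have -> : [:: 0; m; z + m] = L' 0 by rewrite /L' subn0.
    apply: bs_rep_frame => // j ltj.
    apply: bs_seq (bs_inc _ _ _ _) (bs_ext _ (bs_inc _ _ _ _)).
    by rewrite /= -addnS subnSK.
  apply: bs_seq (bs_mv _ _ _ _) (bs_ext _ (bs_inc _ _ _ _)) => //=.
  rewrite addn0; congr (frame _ _ [:: _; _; _]); rewrite /z.
  have := leq_tri lt; rewrite triS; lia.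
by apply: bs_ext (bs_mv _ _ _ _) => //=; rewrite addn0; frame_eq.
Qed.

Lemma ncomp_id : ncomp id.
Proof.
move=> d; exists (mv d 1 0) => rho x.
by apply: bs_loop_nil; rewrite frame_reg.
Qed.

Lemma ncomp_comp f g : ncomp f -> ncomp g -> ncomp (fun x => g (f x)).
Proof.
by move=> F G d; have [c1 H1] := F d; have [c2 H2] := G d; exists (Seq c1 c2) => rho x;
  apply: bs_seq (H1 _ _) (H2 _ _).
Qed.

Lemma ncomp_zero : ncomp (fun=> 0).
Proof.
move=> d; exists (rep (d + 0) (mv d 1 1)) => rho x.
by apply: bs_ext (bs_clear _ _ (i := 0) (t := 1) _ _).
Qed.

Lemma ncomp_succ : ncomp S.
Proof.
by move=> d; exists (Push (d + 0) true) => rho x; apply: bs_ext (bs_inc _ _ _ _).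
Qed.

Lemma ncomp_fst : ncomp (fun z => (unpair z).1).
Proof.
move=> d; have [c Hc] := bs_unpair d.
exists (Seq c (Seq (mv d 1 0) (rep (d + 2) (mv d 1 1)))) => rho z.
apply: bs_seq (Hc _ _) (bs_seq (bs_mv _ _ _ _) (bs_ext _ (bs_clear _ _ _ _))) => //=.
by rewrite addn0; frame_eq.
Qed.

Lemma ncomp_snd : ncomp (fun z => (unpair z).2).
Proof.
move=> d; have [c Hc] := bs_unpair d.
exists (Seq c (Seq (mv d 2 0) (rep (d + 1) (mv d 2 2)))) => rho z.
apply: bs_seq (Hc _ _) (bs_seq (bs_mv _ _ _ _) (bs_ext _ (bs_clear _ _ _ _))) => //=.
by rewrite addn0; frame_eq.
Qed.

Lemma ncomp_pair f g : ncomp f -> ncomp g -> ncomp (fun x => pair_nat (f x) (g x)).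
Proof.
move=> F G d; have [cp Hp] := bs_pair d; have [cc Hcc] := bs_copy d.
have [cf Hf] := F (d + 1); have [cg Hg] := G (d + 2).
exists (Seq cc (Seq cf (Seq (mv d 0 2) (Seq cg (Seq (mv d 1 0) (Seq (mv d 2 1) cp)))))).
move=> rho x; apply: bs_seq (Hcc _ _) _.
apply: bs_seq (bs_above (l := [:: x]) _ _ Hf) _.
apply: bs_seq (bs_mv _ _ _ _) _ => //=; rewrite addn0.
apply: bs_seq (bs_above (l := [:: 0; f x]) _ _ Hg) _.
apply: bs_seq (bs_mv _ _ _ _) _ => //=; rewrite addn0.
apply: bs_seq (bs_mv _ _ _ _) _ => //=; rewrite addn0.
by rewrite (_ : frame rho d _ = frame rho d [:: f x; g x]) //; frame_eq.
Qed.

Lemma ncomp_iter f : ncomp f -> ncomp (fun z => iter (unpair z).1 f (unpair z).2).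
Proof.
move=> F d; have [cu Hu] := bs_unpair d; have [cf Hf] := F (d + 1).
exists (Seq cu (Seq (mv d 1 0) (Seq (mv d 2 1) (Seq (rep (d + 0) cf) (mv d 1 0))))).
move=> rho z; apply: bs_seq (Hu _ _) _; case: (unpair z) => n y /=.
apply: bs_seq (bs_mv _ _ _ _) _ => //=; rewrite (addn0 n).
apply: bs_seq (bs_mv _ _ _ _) _ => //=; rewrite (addn0 y).
apply: (@bs_seq _ _ _ (frame rho d [:: 0; iter n f y])).
  pose L m := [:: m; iter (n - m) f y].
  have -> : frame rho d [:: n; y; 0] = frame rho d (L n) by rewrite /L subnn; frame_eq.
  have -> : [:: 0; iter n f y] = L 0 by rewrite /L subn0.
  apply: bs_rep_frame => // m lt; rewrite /L -(subnSK lt) iterS.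
  exact: (bs_above (l := [:: m]) _ _ Hf).
by apply: bs_ext (bs_mv _ _ _ _) => //=; rewrite addn0; frame_eq.
Qed.

(** * Words as input and output, and unbounded search *)

Definition code_bits (x : seq bool) : nat :=
  foldr (fun (b : bool) n => (pair_nat b n).+1) 0 x.

Definition io (w : seq bool) : stacks := fun=> w.

Lemma upd_io w w' l : upd (frame (io w) 1 l) 0 w' = frame (io w') 1 l.
Proof. by apply: funext => -[|j]. Qed.

Lemma ncomp_cons (b : bool) : ncomp (fun n => (pair_nat b n).+1).
Proof.
apply: ncomp_comp ncomp_succ; apply: ncomp_pair ncomp_id.
by case: b => //; [apply: ncomp_comp ncomp_zero ncomp_succ | apply: ncomp_zero].
Qed.

(** The last digit is on top of the stack, so popping conses the digits from the end of the word to
    its beginning, as [code_bits] requires. *)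
Lemma bs_input : exists c, forall x,
  bs c (input_stacks x) (frame (io [::]) 1 [:: code_bits x]).
Proof.
have [c0 H0] := ncomp_cons false 1; have [c1 H1] := ncomp_cons true 1.
exists (Loop 0 c0 c1) => x.
have -> : input_stacks x = frame (io (rev x)) 1 [:: 0].
  by apply: funext => -[|[|j]] //=; rewrite /frame nth_default.
have -> : code_bits x = foldl (fun n (b : bool) => (pair_nat b n).+1) 0 (rev x).
  by rewrite foldl_rev.
suff H r n : bs (Loop 0 c0 c1) (frame (io r) 1 [:: n]) (frame (io [::]) 1
    [:: foldl (fun n (b : bool) => (pair_nat b n).+1) n r]) by apply: H.
elim: r n => [|b r IH] n /=; first exact: bs_loop_nil.
apply: bs_loop_cons (IH _); first by [].
by rewrite upd_io; case: b.
Qed.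

Lemma bs_output : exists c, forall y,
  bs c (frame (io [::]) 1 [:: code_bits y]) (input_stacks y).
Proof.
have [cu Hu] := bs_unpair 1.
pose c := Seq cu (Seq (mv 1 2 0) (Case (1 + 1) (Push 0 false) (Push 0 true))).
exists (rep (1 + 0) c) => y.
have -> : input_stacks y = frame (io (rev y)) 1 [:: 0].
  by apply: funext => -[|[|j]] //=; rewrite /frame nth_default.
rewrite /rev; elim: y [::] => [|b y IH] w; first by apply: bs_loop_nil; rewrite frame_reg.
apply: bs_loop_cons (IH (b :: w)); first by rewrite frame_reg.
rewrite /= -/(nseq _ true) upd_frame /=; apply: bs_seq (Hu _ _) _.
rewrite pair_natK; apply: bs_seq (bs_mv _ _ _ _) _ => //=; rewrite addn0.
have fE l : frame (io (b :: w)) 1 l = upd (frame (io w) 1 l) 0 (b :: frame (io w) 1 l 0).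
  by rewrite upd_io.
have l0 : frame (io w) 1 [:: code_bits y] = frame (io w) 1 [:: code_bits y; 0; 0].
  by frame_eq.
rewrite fE l0; case: b {fE} => /=; last first.
  by apply: bs_case0 => //; apply: bs_push.
by apply: (@bs_caseS _ _ _ _ _ _ _ 0) => //; apply: bs_push.
Qed.

(** The program keeps the state and a copy of it replaced by its test, and loops while the test is
    [1]. Big-step semantics says nothing about divergence, so the second claim is proved on the
    compiled code, by following the visits to the head of the loop. *)
Theorem search_machine (ini g test out : nat -> nat) :
  ncomp ini -> ncomp g -> ncomp test -> ncomp out ->
  exists M, forall x, let s n := iter n g (ini (code_bits x)) in
    (forall n y, (forall m, m < n -> test (s m) = 1) -> test (s n) = 0 ->
       out (s n) = code_bits y -> computes M x y) /\
    ((forall n, test (s n) = 1) -> ~ dom M x).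
Proof.
move=> /(_ 1)[ci Hi] /(_ 1)[cg Hg] /(_ (1 + 1))[ct Ht] /(_ 1)[co Ho].
have [cin Hin] := bs_input; have [cout Hout] := bs_output; have [cc Hc] := bs_copy 1.
pose pre := Seq cin (Seq ci (Seq cc ct)).
pose body := Seq cg (Seq cc ct).
pose loop := rep (1 + 1) body.
pose main := Seq pre (Seq loop (Seq co cout)).
pose P := INIT :: compile 1 (clen main).+1 main.
pose k := maxn 1 (regs main).
have k0 : 0 < k by rewrite leq_max.
have kR : regs main <= k by rewrite leq_maxr.
have sizeP : size P = (clen main).+1 by apply: (congr1 S (size_compile 1 (clen main).+1 main)).
have codeP : code_at P 1 (compile 1 (clen main).+1 main).
  by move=> j lt; split=> //; rewrite size_compile in lt; rewrite sizeP add1n ltnS.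
have Hbody rho z : bs body (frame rho 1 [:: z]) (frame rho 1 [:: g z; test (g z)]).
  by apply: bs_seq (Hg _ _) (bs_seq (Hc _ _) (bs_above (l := [:: g z]) _ _ Ht)).
have Hpre x : bs pre (input_stacks x)
    (frame (io [::]) 1 [:: ini (code_bits x); test (ini (code_bits x))]).
  apply: bs_seq (Hin _) (bs_seq (Hi _ _) (bs_seq (Hc _ _) _)).
  exact: (bs_above (l := [:: ini (code_bits x)]) _ _ Ht).
have f0 z : frame (io [::]) 1 [:: z] = frame (io [::]) 1 [:: z; 0] by frame_eq.
exists (tm k P) => x /=; set s0 := ini (code_bits x).
have [c1 R1 H1] := start_tm x k0 (isT : 0 < size P) (erefl : nth INIT P 0 = INIT).
split=> [n y T1 T0 Ey|T1].
  have Hloop : bs loop (frame (io [::]) 1 [:: s0; test s0])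
      (frame (io [::]) 1 [:: iter n g s0]).
    elim: n s0 T1 T0 {Ey} => [|n IH] z T1 T0.
      by rewrite /= in T0; rewrite T0 -f0; apply: bs_loop_nil; rewrite f0 frame_reg.
    apply: bs_loop_cons; first by rewrite frame_reg (T1 0).
      by rewrite -[[::]]/(nseq 0 true) upd_frame /= -f0; apply: Hbody.
    rewrite iterSr; apply: IH => [m lt|]; last by rewrite -iterSr.
    by rewrite -iterSr; apply: T1.
  have Hmain : bs main (input_stacks x) (input_stacks y).
    apply: bs_seq (Hpre _) (bs_seq Hloop (bs_seq (Ho _ _) _)).
    by rewrite Ey; apply: Hout.
  have [c2 R2 H2] := compile_correct Hmain kR codeP H1.
  rewrite -sizeP in H2.
  have [|S2 D2] := halt_tm k0 H2; first by case.
  have [n2 Hn2] := reach_trans R1 (reach1_reach R2).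
  by exists n2, c2; split=> //; rewrite D2 revK.
move=> [y [n [c [Hn Hst _]]]].
have [codepre coderest] := code_at_seq (c1 := pre) codeP.
have [codeloop _] := code_at_seq (c1 := loop) coderest.
have [ltl El _ codebody] := code_at_loop codeloop.
have kpre : regs pre <= k by apply: leq_trans kR; apply: leq_maxl.
have kloop : regs loop <= k.
  by apply: leq_trans kR; rewrite leq_max [X in _ || X]leq_max leqnn orbT.
have kl : 1 + 1 < k by apply: leq_trans kloop; apply: leq_maxl.
have kb : regs body <= k by apply: leq_trans kloop; rewrite leq_max maxnn leqnn orbT.
have [c2 R2 H2] := compile_correct (Hpre x) kpre codepre H1.
(* The address and the stacks at the [n]-th visit to the head of the loop; the test register always
   holds [1], that is, a single bit to pop. *)
pose X n := (1 + clen pre, frame (io [::]) 1 [:: iter n g s0; 1]).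
have HX m : goes k P (X m).1 (X m).2 (X m.+1).1 (X m.+1).2.
  have HL : (X m).2 (1 + 1) = [:: true] := frame_reg _ _ _ 1.
  apply: goes_trans (goes_pop_cons ltl El kl HL) _.
  have /compile_correct : bs body (upd (X m).2 (1 + 1) [::]) (X m.+1).2.
    rewrite /X -[[::]]/(nseq 0 true) upd_frame /= -f0.
    by rewrite -[X in frame _ _ [:: _; X]](T1 m.+1) iterS.
  by move/(_ _ _ kb _ _ codebody).
rewrite -/s0 [test s0](T1 0) in H2.
have never := goes_loop_forever HX H2.
have [N HN] := reach_trans R1 (reach1_reach R2).
(* A run that halts after [n] steps is at [None] from step [n.+1] on, although it passes through
   [c2], from which no number of steps leads to [None]. *)
apply: (never (n.+1)); have noneS j : iter j (obind (step (tm k P))) None = None.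
  by elim: j => //= j ->.
by rewrite -HN -iterD addnC iterD iterS Hn /= Hst noneS.
Qed.

Lemma ncomp_const n : ncomp (fun=> n).
Proof. elim: n => [|n IH]; [exact: ncomp_zero | exact: ncomp_comp IH ncomp_succ]. Qed.

(* The conditional is an iteration of [(u, v) |-> (u, u)] from [(f x, g x)]. *)
Lemma ncomp_if b f g : ncomp b -> ncomp f -> ncomp g ->
  ncomp (fun x => if b x == 0 then g x else f x).
Proof.
move=> B F G.
have dup : ncomp (fun p => pair_nat (unpair p).1 (unpair p).1).
  by apply: ncomp_pair ncomp_fst ncomp_fst.
apply: ncomp_ext (ncomp_comp (ncomp_comp (ncomp_pair B (ncomp_pair F G)) (ncomp_iter dup)) ncomp_snd).
move=> x; rewrite pair_natK /=; case: (b x) => [|n]; rewrite /= ?pair_natK //.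
suff -> : iter n (fun p => pair_nat (unpair p).1 (unpair p).1) (pair_nat (f x) (g x)) =
    pair_nat (f x) (if n == 0 then g x else f x) by rewrite pair_natK.
by elim: n => //= n ->; rewrite pair_natK.
Qed.

(** Iterating [(u, v) |-> (v, v + 1)] from [(0, 0)], whose code is [0], leads to [(n.-1, n)] after
    [n] rounds. *)
Lemma ncomp_pred : ncomp predn.
Proof.
have st : ncomp (fun p => pair_nat (unpair p).2 (unpair p).2.+1).
  exact: ncomp_pair ncomp_snd (ncomp_comp ncomp_snd ncomp_succ).
apply: ncomp_ext (ncomp_comp (ncomp_comp (ncomp_pair ncomp_id (ncomp_const 0)) (ncomp_iter st)) ncomp_fst).
move=> n; rewrite pair_natK /=.
have -> : iter n (fun p => pair_nat (unpair p).2 (unpair p).2.+1) 0 = pair_nat n.-1 n.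
  by elim: n => //= n ->; rewrite pair_natK.
by rewrite pair_natK.
Qed.

(** * Computability on encoded types *)

Class Enc (A : Type) := enc : A -> nat.
Instance enc_nat : Enc nat := id.
Instance enc_bool : Enc bool := nat_of_bool.
Instance enc_prod A B (_ : Enc A) (_ : Enc B) : Enc (A * B) :=
  fun p => pair_nat (enc p.1) (enc p.2).
(** The empty list is [0] and all others are positive, so that matching is a zero test followed by a
    predecessor; the same holds for options. *)
Instance enc_seq A (_ : Enc A) : Enc (seq A) :=
  foldr (fun a n => (pair_nat (enc a) n).+1) 0.
Instance enc_option A (_ : Enc A) : Enc (option A) :=
  fun o => if o is Some a then (enc a).+1 else 0.
Instance enc_move : Enc move := fun m => if m is MoveR then 1 else 0.
Instance enc_instr : Enc instr :=
  fun i => enc (istate i, (iread i, (inext i, (iwrite i, imove i)))).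
Instance enc_config : Enc config := fun c => enc (cstate c, (ltape c, rtape c)).

(** The numeric function is constrained on codes only; its values elsewhere are arbitrary. *)
Definition cf {A B : Type} {EA : Enc A} {EB : Enc B} (f : A -> B) : Prop :=
  exists g, ncomp g /\ forall a, g (enc a) = enc (f a).

Section Closure.
Context {A B C D : Type} {EA : Enc A} {EB : Enc B} {EC : Enc C} {ED : Enc D}.

Lemma cf_ext (f g : A -> B) : f =1 g -> cf f -> cf g.
Proof. by move=> E [h [H Hh]]; exists h; split=> // a; rewrite -E. Qed.

Lemma cf_coerce (f : A -> B) : (forall a, enc (f a) = enc a) -> cf f.
Proof. by move=> E; exists id; split=> [|a]; [exact: ncomp_id | rewrite E]. Qed.

Lemma cf_comp (f : A -> B) (g : B -> C) : cf f -> cf g -> cf (fun a => g (f a)).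
Proof.
move=> [f' [F Ef]] [g' [G Eg]]; exists (fun x => g' (f' x)).
by split=> [|a]; [exact: ncomp_comp | rewrite Ef Eg].
Qed.

Lemma cf_const (b : B) : cf (fun _ : A => b).
Proof. by exists (fun=> enc b); split=> //; apply: ncomp_const. Qed.

Lemma cf_pair (f : A -> B) (g : A -> C) : cf f -> cf g -> cf (fun a => (f a, g a)).
Proof.
move=> [f' [F Ef]] [g' [G Eg]]; exists (fun x => pair_nat (f' x) (g' x)).
by split=> [|a]; [exact: ncomp_pair | rewrite Ef Eg].
Qed.

Lemma cf_fst (f : A -> B * C) : cf f -> cf (fun a => (f a).1).
Proof.
move=> [f' [F Ef]]; exists (fun x => (unpair (f' x)).1).
by split=> [|a]; [exact: ncomp_comp F ncomp_fst | rewrite Ef pair_natK].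
Qed.

Lemma cf_snd (f : A -> B * C) : cf f -> cf (fun a => (f a).2).
Proof.
move=> [f' [F Ef]]; exists (fun x => (unpair (f' x)).2).
by split=> [|a]; [exact: ncomp_comp F ncomp_snd | rewrite Ef pair_natK].
Qed.

Lemma cf_if (b : A -> bool) (f g : A -> B) :
  cf b -> cf f -> cf g -> cf (fun a => if b a then f a else g a).
Proof.
move=> [b' [H Eb]] [f' [F Ef]] [g' [G Eg]].
exists (fun x => if b' x == 0 then g' x else f' x).
by split=> [|a]; [exact: ncomp_if | rewrite Eb Ef Eg; case: (b a)].
Qed.

Lemma cf_succ (f : A -> nat) : cf f -> cf (fun a => (f a).+1).
Proof.
move=> [f' [F Ef]]; exists (fun x => (f' x).+1).
by split=> [|a]; [exact: ncomp_comp F ncomp_succ | rewrite Ef].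
Qed.

Lemma cf_pred (f : A -> nat) : cf f -> cf (fun a => (f a).-1).
Proof.
move=> [f' [F Ef]]; exists (fun x => (f' x).-1).
by split=> [|a]; [exact: ncomp_comp F ncomp_pred | rewrite Ef].
Qed.

(** [ncomp_iter] iterates a function of the state alone, so the parameter [a] is carried along in
    the state. *)
Lemma cf_iter (n : A -> nat) (b : A -> B) (s : A -> B -> B) :
  cf n -> cf b -> cf (fun p : A * B => s p.1 p.2) ->
  cf (fun a => iter (n a) (s a) (b a)).
Proof.
move=> [n' [N En]] [b' [H Eb]] [s' [S Es]].
pose st z := pair_nat (unpair z).1 (s' z).
have cst : ncomp st := ncomp_pair ncomp_fst S.
exists (fun x => (unpair (iter (n' x) st (pair_nat x (b' x)))).2); split=> [|a].
  apply: ncomp_ext (ncomp_comp (ncomp_comp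
    (ncomp_pair N (ncomp_pair ncomp_id H)) (ncomp_iter cst)) ncomp_snd) => x.
  by rewrite pair_natK.
rewrite En Eb.
have it k : iter k st (pair_nat (enc a) (enc (b a))) =
    pair_nat (enc a) (enc (iter k (s a) (b a))); last by rewrite it pair_natK.
elim: k => //= k ->; rewrite /st pair_natK.
by congr pair_nat; apply: (Es (a, iter k (s a) (b a))).
Qed.

Lemma cf_Some (f : A -> B) : cf f -> cf (fun a => Some (f a)).
Proof.
move=> [f' [F Ef]]; exists (fun x => (f' x).+1).
by split=> [|a]; [exact: ncomp_comp F ncomp_succ | rewrite Ef].
Qed.

Lemma cf_option (o : A -> option B) (n : A -> C) (s : A -> B -> C) :
  cf o -> cf n -> cf (fun p : A * B => s p.1 p.2) ->
  cf (fun a => if o a is Some b then s a b else n a).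
Proof.
move=> [p1 [H Eo]] [n' [N En]] [s' [S Es]].
exists (fun x => if p1 x == 0 then n' x else s' (pair_nat x (p1 x).-1)); split=> [|a].
  apply: ncomp_if => //; apply: ncomp_comp S; apply: ncomp_pair ncomp_id _.
  exact: ncomp_comp H ncomp_pred.
rewrite Eo En; case: (o a) => [b|] //=.
exact: (Es (a, b)).
Qed.

Lemma cf_seq (l : A -> seq B) (n : A -> C) (s : A -> B -> seq B -> C) :
  cf l -> cf n -> cf (fun p : A * (B * seq B) => s p.1 p.2.1 p.2.2) ->
  cf (fun a => if l a is x :: t then s a x t else n a).
Proof.
move=> [p1 [H Eo]] [n' [N En]] [s' [S Es]].
exists (fun x => if p1 x == 0 then n' x else s' (pair_nat x (p1 x).-1)); split=> [|a].
  apply: ncomp_if => //; apply: ncomp_comp S; apply: ncomp_pair ncomp_id _.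
  exact: ncomp_comp H ncomp_pred.
rewrite Eo En; case: (l a) => [|x t] //=.
exact: (Es (a, (x, t))).
Qed.

Lemma cf_cons (f : A -> B) (l : A -> seq B) : cf f -> cf l -> cf (fun a => f a :: l a).
Proof.
move=> [f' [F Ef]] [l' [L El]]; exists (fun x => (pair_nat (f' x) (l' x)).+1).
by split=> [|a]; [exact: ncomp_comp (ncomp_pair F L) ncomp_succ | rewrite Ef El].
Qed.

End Closure.

Lemma cf_id {A : Type} {EA : Enc A} : cf (fun a : A => a).
Proof. exact: cf_coerce. Qed.

Ltac cf_proj := repeat first [simple apply cf_id | simple apply cf_fst | simple apply cf_snd].

(** Makes the code of a list usable as a number of iterations before the length is known to be
    computable. *)
Lemma size_leq_enc {B : Type} {EB : Enc B} (l : seq B) : size l <= enc l.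
Proof. by elim: l => //= x l IH; rewrite ltnS /pair_nat; apply: leq_trans IH (leq_addl _ _). Qed.

Section Folds.
Context {A B C : Type} {EA : Enc A} {EB : Enc B} {EC : Enc C}.

Lemma cf_foldl (l : A -> seq B) (b : A -> C) (f : A -> C -> B -> C) :
  cf l -> cf b -> cf (fun p : A * (C * B) => f p.1 p.2.1 p.2.2) ->
  cf (fun a => foldl (f a) (b a) (l a)).
Proof.
move=> L H F.
pose st a (p : seq B * C) := if p.1 is x :: t then (t, f a p.2 x) else p.
(* [enc (l a)] iterations suffice, as the step is the identity on [[::]]. *)
have E a : foldl (f a) (b a) (l a) = (iter (enc (l a)) (st a) (l a, b a)).2.
  rewrite -(subnK (size_leq_enc (l a))) iterD.
  have -> : iter (size (l a)) (st a) (l a, b a) = ([::], foldl (f a) (b a) (l a)).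
    by elim: (l a) (b a) => //= x t IH c; rewrite -iterS iterSr /= IH.
  suff -> m c : iter m (st a) ([::], c) = ([::], c) by [].
  by elim: m => //= m ->.
apply: cf_ext (fun a => esym (E a)) _; apply: cf_snd.
apply: (cf_iter (n := fun a => enc (l a))).
- by apply: (cf_comp (g := fun l : seq B => enc l) L); apply: cf_coerce.
- exact: cf_pair.
rewrite /st; apply: (cf_seq (l := fun p : A * (seq B * C) => p.2.1)
    (n := fun p => p.2) (s := fun p x t => (t, f p.1 p.2.2 x))).
- by cf_proj.
- by cf_proj.
apply: cf_pair; first by cf_proj.
apply: (cf_comp (B := A * (C * B)) (f := fun p => (p.1.1, (p.1.2.2, p.2.1)))) F.
by apply: cf_pair; last apply: cf_pair; cf_proj.
Qed.
End Folds.

Lemma cf_rev {A B : Type} {EA : Enc A} {EB : Enc B} (l : A -> seq B) :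
  cf l -> cf (fun a => rev (l a)).
Proof.
move=> L; have E a : foldl (fun t x => x :: t) [::] (l a) = rev (l a).
  by rewrite /rev; elim: (l a) [::] => //= x s IH t; rewrite IH.
apply: cf_ext E _; apply: (cf_foldl (f := fun _ t x => x :: t)) => //.
  exact: cf_const.
by apply: cf_cons; cf_proj.
Qed.

Lemma cf_foldr {A B C : Type} {EA : Enc A} {EB : Enc B} {EC : Enc C}
    (l : A -> seq B) (b : A -> C) (f : A -> B -> C -> C) :
  cf l -> cf b -> cf (fun p : A * (B * C) => f p.1 p.2.1 p.2.2) ->
  cf (fun a => foldr (f a) (b a) (l a)).
Proof.
move=> L H F.
apply: (@cf_ext _ _ _ _ (fun a => foldl (fun c x => f a x c) (b a) (rev (l a)))).
  by move=> a; rewrite foldl_rev.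
apply: (cf_foldl (f := fun a c x => f a x c)) => //; first exact: cf_rev.
apply: (cf_comp (B := A * (B * C)) (f := fun p => (p.1, (p.2.2, p.2.1)))) F.
by apply: cf_pair; last apply: cf_pair; cf_proj.
Qed.

Ltac cf_step :=
  first
    [ simple apply cf_id
    | simple apply cf_const
    | match goal with H : @cf _ _ _ _ ?n |- cf (fun p => ?n (@?x p)) =>
        simple apply (cf_comp (f := x) (g := n)); [ | exact H] end
    | assumption
    | simple apply cf_fst
    | simple apply cf_snd
    | simple apply cf_pair
    | simple apply cf_cons
    | simple apply cf_rev
    | simple apply cf_Some
    | simple apply cf_succ
    | simple apply cf_pred
    | simple apply cf_if
    | simple apply cf_iter
    | simple apply cf_option
    | simple apply cf_seq
    | simple apply cf_foldl
    | simple apply cf_foldr ].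
Ltac cf_lib := fail.
Ltac cf_auto := cbn beta; repeat (first [cf_step | cf_lib]; cbn beta).

Lemma cf_add {A : Type} {EA : Enc A} (m n : A -> nat) : cf m -> cf n -> cf (fun a => m a + n a).
Proof.
move=> M N; apply: (@cf_ext _ _ _ _ (fun a => iter (m a) S (n a))).
  by move=> a; elim: (m a) => //= k ->; rewrite addSn.
by cf_auto.
Qed.

Ltac cf_lib ::= simple apply cf_add.

Lemma cf_mul {A : Type} {EA : Enc A} (m n : A -> nat) : cf m -> cf n -> cf (fun a => m a * n a).
Proof.
move=> M N; apply: (@cf_ext _ _ _ _ (fun a => iter (m a) (fun k => n a + k) 0)).
  by move=> a; elim: (m a) => //= k ->; rewrite mulSn.
by cf_auto.
Qed.

Lemma cf_sub {A : Type} {EA : Enc A} (m n : A -> nat) : cf m -> cf n -> cf (fun a => m a - n a).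
Proof.
move=> M N; apply: (@cf_ext _ _ _ _ (fun a => iter (n a) predn (m a))).
  by move=> a; elim: (n a) => [|k IH]; rewrite ?subn0 //= IH subnS.
by cf_auto.
Qed.

Lemma cf_expn {A : Type} {EA : Enc A} (m n : A -> nat) : cf m -> cf n -> cf (fun a => m a ^ n a).
Proof.
move=> M N; apply: (@cf_ext _ _ _ _ (fun a => iter (n a) (fun k => m a * k) 1)).
  by move=> a; elim: (n a) => //= k ->; rewrite expnS.
by cf_auto; apply: cf_mul; cf_auto.
Qed.

Lemma cf_eq0 {A : Type} {EA : Enc A} (m : A -> nat) : cf m -> cf (fun a => m a == 0).
Proof.
move=> M; apply: (@cf_ext _ _ _ _ (fun a => iter (m a) (fun _ => false) true)).
  by move=> a; case: (m a).
by cf_auto.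
Qed.

Lemma cf_negb {A : Type} {EA : Enc A} (b : A -> bool) : cf b -> cf (fun a => ~~ b a).
Proof.
move=> M; apply: (@cf_ext _ _ _ _ (fun a => if b a then false else true)) => //.
by cf_auto.
Qed.

Lemma cf_andb {A : Type} {EA : Enc A} (b c : A -> bool) : cf b -> cf c -> cf (fun a => b a && c a).
Proof.
move=> M N; apply: (@cf_ext _ _ _ _ (fun a => if b a then c a else false)) => //.
by cf_auto.
Qed.

Lemma cf_orb {A : Type} {EA : Enc A} (b c : A -> bool) : cf b -> cf c -> cf (fun a => b a || c a).
Proof.
move=> M N; apply: (@cf_ext _ _ _ _ (fun a => if b a then true else c a)) => //.
by cf_auto.
Qed.

Lemma cf_leq {A : Type} {EA : Enc A} (m n : A -> nat) : cf m -> cf n -> cf (fun a => m a <= n a).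
Proof. by move=> M N; apply: cf_eq0; apply: cf_sub. Qed.

Lemma cf_eqn {A : Type} {EA : Enc A} (m n : A -> nat) : cf m -> cf n -> cf (fun a => m a == n a).
Proof.
move=> M N; apply: (@cf_ext _ _ _ _ (fun a => (m a <= n a) && (n a <= m a))).
  by move=> a; rewrite eqn_leq.
by apply: cf_andb; apply: cf_leq.
Qed.

Lemma cf_nat_of_bool {A : Type} {EA : Enc A} (b : A -> bool) : cf b -> cf (fun a => nat_of_bool (b a)).
Proof. by move=> H; apply: (cf_comp H); apply: cf_coerce. Qed.

Ltac cf_lib ::= first
  [ simple apply cf_add | simple apply cf_mul | simple apply cf_sub
  | simple apply cf_expn | simple apply cf_eq0 | simple apply cf_negb
  | simple apply cf_andb | simple apply cf_orb | simple apply cf_leq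
  | simple apply cf_eqn | simple apply cf_nat_of_bool ].

(** Parity and half are computed together: passing from [k] to [k + 1] flips the parity and adds the
    old parity to the half. *)
Lemma cf_odd_half {A : Type} {EA : Enc A} (n : A -> nat) : cf n -> cf (fun a => (odd (n a), (n a)./2)).
Proof.
move=> N; apply: (@cf_ext _ _ _ _ (fun a => iter (n a)
    (fun p : bool * nat => (~~ p.1, p.1 + p.2)) (false, 0))).
  by move=> a; elim: (n a) => //= k ->; rewrite uphalf_half.
by cf_auto.
Qed.

Lemma cf_odd {A : Type} {EA : Enc A} (n : A -> nat) : cf n -> cf (fun a => odd (n a)).
Proof. by move=> N; apply: (cf_fst (cf_odd_half N)). Qed.

Lemma cf_half {A : Type} {EA : Enc A} (n : A -> nat) : cf n -> cf (fun a => (n a)./2).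
Proof. by move=> N; apply: (cf_snd (cf_odd_half N)). Qed.

(** The code of the pair [unpair z] is [z] itself. *)
Lemma cf_unpair {A : Type} {EA : Enc A} (n : A -> nat) : cf n -> cf (fun a => unpair (n a)).
Proof. by move=> N; apply: (cf_comp N); apply: cf_coerce => z; apply: unpairK. Qed.

Lemma cf_size {A : Type} {EA : Enc A} {B : Type} {EB : Enc B} (l : A -> seq B) : cf l -> cf (fun a => size (l a)).
Proof.
move=> L; apply: (@cf_ext _ _ _ _ (fun a => foldr (fun _ n => n.+1) 0 (l a))).
  by move=> a; elim: (l a) => //= x s ->.
by cf_auto.
Qed.

Lemma cf_behead {A : Type} {EA : Enc A} {B : Type} {EB : Enc B} (l : A -> seq B) : cf l -> cf (fun a => behead (l a)).
Proof.
move=> L; apply: (@cf_ext _ _ _ _ (fun a => if l a is x :: t then t else [::])).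
  by move=> a; case: (l a).
by cf_auto.
Qed.

Lemma cf_head {A : Type} {EA : Enc A} {B : Type} {EB : Enc B} (b : B) (l : A -> seq B) :
  cf l -> cf (fun a => head b (l a)).
Proof.
move=> L; apply: (@cf_ext _ _ _ _ (fun a => if l a is x :: t then x else b)).
  by move=> a; case: (l a).
by cf_auto.
Qed.

Lemma cf_ohead {A : Type} {EA : Enc A} {B : Type} {EB : Enc B} (l : A -> seq B) : cf l -> cf (fun a => ohead (l a)).
Proof.
move=> L; apply: (@cf_ext _ _ _ _ (fun a => if l a is x :: t then Some x else None)).
  by move=> a; case: (l a).
by cf_auto.
Qed.

Lemma cf_nth {A : Type} {EA : Enc A} {B : Type} {EB : Enc B} (b : B) (l : A -> seq B) (n : A -> nat) :
  cf l -> cf n -> cf (fun a => nth b (l a) (n a)).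
Proof.
move=> L N; apply: (@cf_ext _ _ _ _ (fun a => head b (iter (n a) behead (l a)))).
  by move=> a; rewrite -nth0 -(drop_behead (n a)) nth_drop addn0.
by apply: cf_head; cf_auto; apply: cf_behead; cf_auto.
Qed.

Lemma cf_map {A : Type} {EA : Enc A} {B : Type} {EB : Enc B} {C : Type} {EC : Enc C} (l : A -> seq B) (f : A -> B -> C) :
  cf l -> cf (fun p : A * B => f p.1 p.2) -> cf (fun a => [seq f a x | x <- l a]).
Proof.
move=> L F; apply: (@cf_ext _ _ _ _ (fun a => foldr (fun x t => f a x :: t) [::] (l a))) => //.
cf_auto; apply: (cf_comp (B := A * B) (f := fun p => (p.1, p.2.1))) F; cf_auto.
Qed.

Lemma cf_filter {A : Type} {EA : Enc A} {B : Type} {EB : Enc B} (l : A -> seq B) (f : A -> B -> bool) :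
  cf l -> cf (fun p : A * B => f p.1 p.2) -> cf (fun a => [seq x <- l a | f a x]).
Proof.
move=> L F; apply: (@cf_ext _ _ _ _
  (fun a => foldr (fun x t => if f a x then x :: t else t) [::] (l a))) => //.
cf_auto; apply: (cf_comp (B := A * B) (f := fun p => (p.1, p.2.1))) F; cf_auto.
Qed.

Lemma cf_cat {A : Type} {EA : Enc A} {B : Type} {EB : Enc B} (l t : A -> seq B) :
  cf l -> cf t -> cf (fun a => l a ++ t a).
Proof.
move=> L T; apply: (@cf_ext _ _ _ _ (fun a => foldr cons (t a) (l a))).
  by move=> a; elim: (l a) => //= x s ->.
by cf_auto.
Qed.

Lemma cf_nseq {A : Type} {EA : Enc A} {B : Type} {EB : Enc B} (n : A -> nat) (x : A -> B) :
  cf n -> cf x -> cf (fun a => nseq (n a) (x a)).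
Proof.
move=> N X; apply: (@cf_ext _ _ _ _ (fun a => iter (n a) (cons (x a)) [::])) => //.
by cf_auto.
Qed.

Lemma cf_obind {A : Type} {EA : Enc A} {B : Type} {EB : Enc B} {C : Type} {EC : Enc C} (f : A -> B -> option C) (o : A -> option B) :
  cf (fun p : A * B => f p.1 p.2) -> cf o -> cf (fun a => obind (f a) (o a)).
Proof.
move=> F HO; apply: (@cf_ext _ _ _ _ (fun a => if o a is Some b then f a b else None)) => //.
by cf_auto.
Qed.

Lemma cf_omap {A : Type} {EA : Enc A} {B : Type} {EB : Enc B} {C : Type} {EC : Enc C} (f : A -> B -> C) (o : A -> option B) :
  cf (fun p : A * B => f p.1 p.2) -> cf o -> cf (fun a => omap (f a) (o a)).
Proof.
move=> F HO; apply: (@cf_ext _ _ _ _ (fun a => if o a is Some b then Some (f a b) else None)) => //.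
by cf_auto.
Qed.

Ltac cf_lib ::= first
  [ simple apply cf_add | simple apply cf_mul | simple apply cf_sub
  | simple apply cf_expn | simple apply cf_eq0 | simple apply cf_negb
  | simple apply cf_andb | simple apply cf_orb | simple apply cf_leq
  | simple apply cf_eqn | simple apply cf_nat_of_bool
  | simple apply cf_odd | simple apply cf_half | simple apply cf_unpair
  | simple apply cf_size | simple apply cf_behead | simple apply cf_head
  | simple apply cf_ohead | simple apply cf_nth | simple apply cf_map
  | simple apply cf_filter | simple apply cf_cat | simple apply cf_nseq
  | simple apply cf_obind | simple apply cf_omap ].

Theorem search_cf {A : Type} {EA : Enc A} (ini : seq bool -> A) (g : A -> A)
    (test : A -> bool) (out : A -> seq bool) :
  cf ini -> cf g -> cf test -> cf out ->
  exists M, forall x, let s n := iter n g (ini x) in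
    (forall n, (forall m, m < n -> test (s m)) -> ~~ test (s n) ->
       computes M x (out (s n))) /\
    ((forall n, test (s n)) -> ~ dom M x).
Proof.
move=> [ini' [Cini Eini]] [g' [Cg Eg]] [test' [Ct Et]] [out' [Co Eo]].
have [M HM] := search_machine Cini Cg Ct Co; exists M => x /=.
have Es n : iter n g' (ini' (code_bits x)) = enc (iter n g (ini x)).
  by elim: n => [|n IH]; [exact: Eini | rewrite iterS IH Eg].
have [H1 H2] := HM x; split=> [n Hlt Hn|Hall].
  apply: (H1 n); rewrite ?Es ?Et ?Eo //.
    by move=> m /Hlt; rewrite Es Et => ->.
  by rewrite /enc /enc_bool (negbTE Hn).
by apply: H2 => n; rewrite Es Et Hall.
Qed.

Theorem search_option (h : seq bool -> nat -> option (seq bool)) :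
  cf (fun p : seq bool * nat => h p.1 p.2) ->
  exists U, (forall x t y, h x t = Some y -> (forall m, m < t -> h x m = None) ->
      computes U x y) /\
    (forall x, (forall t, h x t = None) -> ~ dom U x).
Proof.
move=> H.
pose test (p : seq bool * nat) := if h p.1 p.2 is Some _ then false else true.
pose out (p : seq bool * nat) := if h p.1 p.2 is Some y then y else [::].
have [||||M HM] := @search_cf _ _ (fun x => (x, 0))
  (fun p : seq bool * nat => (p.1, p.2.+1)) test out.
- by cf_auto.
- by cf_auto.
- by rewrite /test; cf_auto.
- by rewrite /out; cf_auto.
have it x n : iter n (fun p : seq bool * nat => (p.1, p.2.+1)) (x, 0) = (x, n).
  by elim: n => //= n ->.
exists M; split=> [x t y E lt|x E].
  have [/(_ t)] := HM x; rewrite !it /test /out /= E => + _; apply=> // m /lt.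
  by rewrite it /= => ->.
by have [_] := HM x; apply=> n; rewrite it /test /= E.
Qed.

Theorem total_machine (f : seq bool -> seq bool) : cf f ->
  exists F, forall x, computes F x (f x).
Proof.
(* The test fails at once, so the search stops at stage 0 and outputs the initial state [f x]. *)
move=> H; have [||||M HM] := @search_cf _ _ f id (fun=> false) id; try by cf_auto.
by exists M => x; have [/(_ 0 _ isT) H0 _] := HM x; apply: H0.
Qed.

(** * Computability of machine steps, of [bin] and of decoding *)

Lemma cf_fields {A : Type} {EA : Enc A} (f : A -> instr) : cf f ->
  cf (fun a => (istate (f a), (iread (f a), (inext (f a), (iwrite (f a), imove (f a)))))).
Proof.
by move=> F; apply: (cf_comp (g := fun i =>
  (istate i, (iread i, (inext i, (iwrite i, imove i))))) F); apply: cf_coerce.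
Qed.

Lemma cf_istate {A : Type} {EA : Enc A} (f : A -> instr) : cf f -> cf (fun a => istate (f a)).
Proof. by move/cf_fields/cf_fst. Qed.
Lemma cf_iread {A : Type} {EA : Enc A} (f : A -> instr) : cf f -> cf (fun a => iread (f a)).
Proof. by move/cf_fields/cf_snd/cf_fst. Qed.
Lemma cf_inext {A : Type} {EA : Enc A} (f : A -> instr) : cf f -> cf (fun a => inext (f a)).
Proof. by move/cf_fields/cf_snd/cf_snd/cf_fst. Qed.
Lemma cf_iwrite {A : Type} {EA : Enc A} (f : A -> instr) : cf f -> cf (fun a => iwrite (f a)).
Proof. by move/cf_fields/cf_snd/cf_snd/cf_snd/cf_fst. Qed.

Definition to_right (m : move) : bool := if m is MoveR then true else false.

Lemma cf_to_right {A : Type} {EA : Enc A} (f : A -> instr) :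
  cf f -> cf (fun a => to_right (imove (f a))).
Proof.
move/cf_fields/cf_snd/cf_snd/cf_snd/cf_snd => /= H.
by apply: (cf_comp (g := to_right) H); apply: cf_coerce => -[].
Qed.

Lemma cf_Instr {A : Type} {EA : Enc A} (q s n w : A -> nat) (m : A -> bool) :
  cf q -> cf s -> cf n -> cf w -> cf m ->
  cf (fun a => Instr (q a) (s a) (n a) (w a) (if m a then MoveR else MoveL)).
Proof.
move=> Q S N W M.
pose f (p : nat * (nat * (nat * (nat * bool)))) :=
  Instr p.1 p.2.1 p.2.2.1 p.2.2.2.1 (if p.2.2.2.2 then MoveR else MoveL).
apply: (cf_comp (f := fun a => (q a, (s a, (n a, (w a, m a))))) (g := f)); cf_auto.
by apply: cf_coerce => -[a [b [c [d []]]]].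
Qed.

Lemma cf_parts {A : Type} {EA : Enc A} (f : A -> config) : cf f ->
  cf (fun a => (cstate (f a), (ltape (f a), rtape (f a)))).
Proof.
by move=> F; apply: (cf_comp (g := fun c => (cstate c, (ltape c, rtape c))) F); apply: cf_coerce.
Qed.
Lemma cf_cstate {A : Type} {EA : Enc A} (f : A -> config) : cf f -> cf (fun a => cstate (f a)).
Proof. by move/cf_parts/cf_fst. Qed.
Lemma cf_ltape {A : Type} {EA : Enc A} (f : A -> config) : cf f -> cf (fun a => ltape (f a)).
Proof. by move/cf_parts/cf_snd/cf_fst. Qed.
Lemma cf_rtape {A : Type} {EA : Enc A} (f : A -> config) : cf f -> cf (fun a => rtape (f a)).
Proof. by move/cf_parts/cf_snd/cf_snd. Qed.

Lemma cf_Config {A : Type} {EA : Enc A} (q : A -> nat) (l r : A -> seq nat) :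
  cf q -> cf l -> cf r -> cf (fun a => Config (q a) (l a) (r a)).
Proof.
move=> Q L R; apply: (cf_comp (f := fun a => (q a, (l a, r a)))
  (g := fun p : nat * (seq nat * seq nat) => Config p.1 p.2.1 p.2.2)); cf_auto.
by apply: cf_coerce => -[a [b c]].
Qed.

Ltac cf_mach := repeat first
  [ progress cf_auto | simple apply cf_istate | simple apply cf_iread | simple apply cf_inext
  | simple apply cf_iwrite | simple apply cf_to_right | simple apply cf_Instr
  | simple apply cf_cstate | simple apply cf_ltape | simple apply cf_rtape
  | simple apply cf_Config ].

Lemma cf_step {A : Type} {EA : Enc A} (M : A -> machine) (c : A -> config) :
  cf M -> cf c -> cf (fun a => step (M a) (c a)).
Proof.
move=> HM HC; rewrite /step /lookup; apply: cf_omap; last by cf_mach.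
apply: (@cf_ext _ _ _ _ (fun p : A * instr =>
  if to_right (imove p.2) then
    Config (inext p.2) (iwrite p.2 :: ltape (c p.1)) (behead (rtape (c p.1)))
  else Config (inext p.2) (behead (ltape (c p.1)))
         (head 0 (ltape (c p.1)) :: iwrite p.2 :: behead (rtape (c p.1))))).
  by case=> a i; rewrite /exec; case: (imove i).
by cf_mach.
Qed.

Lemma cf_digits {A : Type} {EA : Enc A} (l : A -> seq nat) : cf l -> cf (fun a => digits (l a)).
Proof.
move=> L; apply: (@cf_ext _ _ _ _ (fun a => foldr (fun s t =>
  if s == 1 then false :: t else if s == 2 then true :: t else [::]) [::] (l a))).
  by move=> a; elim: (l a) => //= -[|[|[|s]]] t ->.
by cf_auto.
Qed.

Lemma cf_init {A : Type} {EA : Enc A} (x : A -> seq bool) : cf x -> cf (fun a => init (x a)).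
Proof. by move=> X; rewrite /init; cf_mach. Qed.

Lemma bin1 : bin 1 = [::].
Proof. by []. Qed.

Lemma bin_half n : 1 < n -> bin n = rcons (bin n./2) (odd n).
Proof.
move=> lt1; rewrite /bin trunc_log2S // mkseqS subnn divn1; congr rcons.
apply/eq_in_map => i; rewrite mem_iota add0n /= => lti.
by rewrite subSS -(subnSK lti) expnS divnMA divn2.
Qed.

Lemma cf_bin {A : Type} {EA : Enc A} (n : A -> nat) : cf n -> cf (fun a => bin (n a).+1).
Proof.
(* [F] moves the lowest digit in front of the accumulated word and stops at 1, the leading digit
   that [bin] drops; as halving decreases a number above 1, [(n a).+1] rounds suffice. *)
move=> N; pose F (s : nat * seq bool) := if s.1 <= 1 then s else (s.1./2, odd s.1 :: s.2).
apply: (@cf_ext _ _ _ _ (fun a => (iter (n a).+1 F ((n a).+1, [::])).2)).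
  move=> a; suff H m k acc : 0 < k -> k <= m ->
      (iter m F (k, acc)).2 = bin k ++ acc by rewrite H ?cats0.
  elim: m k acc => [|m IH] k acc k0 lem; first by lia.
  rewrite iterSr {2}/F /=; case: (leqP k 1) => [le1|lt1].
    have -> : k = 1 by lia.
    suff -> : iter m F (1, acc) = (1, acc) by rewrite bin1.
    by elim: (m) => //= j ->.
  rewrite IH; first by rewrite (bin_half lt1) cat_rcons.
    by rewrite half_gt0.
  by rewrite leq_half_double (leq_trans lem) // ltnS -addnn leq_addr.
rewrite /F; cf_auto.
Qed.

(** The state holds the instructions read so far, the finished fields of the current one, both in
    reverse order, and the unary number being read. Once four fields are present, the next bit is
    the move. *)
Definition dstep (s : seq instr * (seq nat * nat)) (b : bool) :
    seq instr * (seq nat * nat) :=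
  let fs := s.2.1 in
  if size fs < 4 then
    if b then (s.1, (fs, s.2.2.+1)) else (s.1, (s.2.2 :: fs, 0))
  else (Instr (nth 0 fs 3) (nth 0 fs 2) (nth 0 fs 1) (nth 0 fs 0)
          (if b then MoveR else MoveL) :: s.1, ([::], 0)).

Definition decode (w : seq bool) : seq instr := rev (foldl dstep ([::], ([::], 0)) w).1.

Lemma decodeK M : decode (code M) = M.
Proof.
have nat_ok Mr fs n k s : size fs < 4 ->
    foldl dstep (Mr, (fs, k)) (code_nat n ++ s) = foldl dstep (Mr, (n + k :: fs, 0)) s.
  by move=> lt; elim: n k => [|n IH] k /=; rewrite /dstep /= lt // IH addnS.
suff H Mr : foldl dstep (Mr, ([::], 0)) (code M) = (rev M ++ Mr, ([::], 0)).
  by rewrite /decode H cats0 revK.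
rewrite /code; elim: M Mr => [|i M IH] Mr //=; rewrite rev_cons cat_rcons -IH.
rewrite /code_instr -!catA !nat_ok // !addn0 /= {2}/dstep /=; congr foldl.
by case: i => q s n v []; congr (_ :: _, _).
Qed.

Lemma cf_decode {A : Type} {EA : Enc A} (w : A -> seq bool) : cf w -> cf (fun a => decode (w a)).
Proof. move=> W; rewrite /decode /dstep; by cf_mach. Qed.

(** A prefix-free code: [true] announces a further bit and [false] ends the word. *)
Definition delimit (w : seq bool) : seq bool :=
  foldr (fun b s => true :: b :: s) [:: false] w.

Definition undelimit_step (s : seq bool * seq bool) : seq bool * seq bool :=
  if s.1 is b :: t then
    if b then (if t is c :: t' then (t', c :: s.2) else s) else s
  else s.

(** The step is idle at the final [false], so [size x] rounds are enough; [behead] then removes that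
    [false]. *)
Definition undelimit (x : seq bool) : seq bool * seq bool :=
  let s := iter (size x) undelimit_step (x, [::]) in (rev s.2, behead s.1).

Lemma undelimitK w p : undelimit (delimit w ++ p) = (w, p).
Proof.
have H acc n : iter (size w + n) undelimit_step (delimit w ++ p, acc) = (false :: p, rev w ++ acc).
  elim: w acc => [|b w IH] acc /=.
    by elim: n => //= n ->.
  by rewrite -iterS iterSr /= IH rev_cons cat_rcons.
have le : size w <= size (delimit w ++ p).
  by elim: (w) => //= b v; lia.
by rewrite /undelimit -(subnKC le) H cats0 /= revK.
Qed.

Lemma cf_delimit {A : Type} {EA : Enc A} (w : A -> seq bool) : cf w -> cf (fun a => delimit (w a)).
Proof. by move=> W; rewrite /delimit; cf_auto. Qed.

Lemma cf_undelimit {A : Type} {EA : Enc A} (w : A -> seq bool) :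
  cf w -> cf (fun a => undelimit (w a)).
Proof. by move=> W; rewrite /undelimit /undelimit_step; cf_auto. Qed.

(** * Search for a maximal dyadic interval *)

Definition run (V : machine) (a s : nat) : option config :=
  iter s (obind (step V)) (Some (init (bin a.+1))).

(* [fire V t = Some (n, y)] when [t] codes a pair [(n - 1, s)] such that [V]
   halts on [bin n] after exactly [s] steps, with output [y]. *)
Definition fire (V : machine) (t : nat) : option (nat * seq bool) :=
  if run V (unpair t).1 (unpair t).2 is Some c then
    if step V c is Some _ then None else Some ((unpair t).1.+1, digits (rtape c))
  else None.

(* numerator and denominator of the sum of the [1 / n] fired before [t] (the
   fraction is not reduced) *)
Definition frac (V : machine) (t : nat) : nat * nat :=
  (iter t (fun s : nat * (nat * nat) => (s.1.+1,
     if fire V s.1 is Some q then (s.2.1 * q.1 + s.2.2, s.2.2 * q.1) else s.2))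
   (0, (0, 1))).2.

Definition val2 (p : seq bool) : nat := foldl (fun a (b : bool) => a + a + b) 0 p.

(* The dyadic interval of [p] lies in [[f, f + 1 / n)], where [f] is a fraction;
   the denominators are cleared. *)
Definition inside (f : nat * nat) (n : nat) (p : seq bool) : bool :=
  (f.1 * 2 ^ size p <= val2 p * f.2) &&
  ((val2 p).+1 * (f.2 * n) <= (f.1 * n + f.2) * 2 ^ size p).

Definition parent (p : seq bool) : seq bool := rev (behead (rev p)).

(** When [D] is closed under extension, these are the words of [D] with no proper prefix in [D],
    since the longest one decides. For the dyadic intervals contained in a given interval they are
    the maximal ones. The empty word is its own [parent], hence the separate case. *)
Definition minimal (D : seq bool -> bool) (p : seq bool) : bool :=
  D p && ((size p == 0) || ~~ D (parent p)).

Definition hit (V : machine) (p : seq bool) (t : nat) : option (seq bool) :=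
  if fire V t is Some q then
    if minimal (inside (frac V t) q.1) p then Some q.2 else None
  else None.

Lemma cf_fire {A : Type} {EA : Enc A} (V : A -> machine) (t : A -> nat) :
  cf V -> cf t -> cf (fun a => fire (V a) (t a)).
Proof.
move=> HV T; rewrite /fire /run.
by repeat first [progress cf_mach | simple apply cf_step | simple apply cf_init
  | simple apply cf_bin | simple apply cf_digits].
Qed.

Lemma cf_frac {A : Type} {EA : Enc A} (V : A -> machine) (t : A -> nat) :
  cf V -> cf t -> cf (fun a => frac (V a) (t a)).
Proof. by move=> HV T; rewrite /frac; cf_auto; apply: cf_fire; cf_auto. Qed.

Lemma cf_hit {A : Type} {EA : Enc A} (V : A -> machine) (p : A -> seq bool) (t : A -> nat) :
  cf V -> cf p -> cf t -> cf (fun a => hit (V a) (p a) (t a)).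
Proof.
move=> HV P T; rewrite /hit /minimal /parent /inside /val2; cf_auto;
  first [apply: cf_fire | apply: cf_frac]; cf_auto.
Qed.

Theorem universal_searcher : exists U,
  forall V p, let x := delimit (code V) ++ p in
    (forall t y, hit V p t = Some y -> (forall m, m < t -> hit V p m = None) ->
       computes U x y) /\
    ((forall t, hit V p t = None) -> ~ dom U x).
Proof.
pose h x t := hit (decode (undelimit x).1) (undelimit x).2 t.
have [|U [H1 H2]] := @search_option h.
  rewrite /h; apply: cf_hit; cf_auto; first apply: cf_decode; cf_auto;
    apply: cf_undelimit; cf_auto.
exists U => V p x; have E t : h x t = hit V p t by rewrite /h undelimitK decodeK.
split=> [t y Hy lt|Hn]; last by apply: H2 => t; rewrite E.
by apply: (H1 _ t) => [|m /lt]; rewrite E.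
Qed.

(** * Prepending a word to the input *)

Definition halts (M : machine) (c : config) (y : seq bool) : Prop :=
  exists n c', [/\ iter n (obind (step M)) (Some c) = Some c',
                  step M c' = None & digits (rtape c') = y].

Lemma halts_step M c c1 y : step M c = Some c1 -> halts M c y <-> halts M c1 y.
Proof.
move=> S; split=> [[[|n] [c' [Hn Hs Hd]]]|[n [c' [Hn Hs Hd]]]].
- by move: Hn => /= -[E]; rewrite -E S in Hs.
- by exists n, c'; split=> //; rewrite -Hn iterSr /= S.
- by exists n.+1, c'; split=> //; rewrite iterSr /= S.
Qed.

(** Equality of the tapes as infinite tapes: two lists may differ in the blanks written explicitly
    at their ends. *)
Definition eqc (c c' : config) : Prop :=
  [/\ cstate c = cstate c', nth 0 (ltape c) =1 nth 0 (ltape c') &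
      nth 0 (rtape c) =1 nth 0 (rtape c')].

Lemma eqc_sym c c' : eqc c c' -> eqc c' c.
Proof. by case=> E1 E2 E3; split=> // j; rewrite ?E2 ?E3. Qed.

Lemma step_eqc M c c' d : eqc c c' -> step M c = Some d ->
  exists2 d', step M c' = Some d' & eqc d d'.
Proof.
move=> [E1 E2 E3]; rewrite /step -!nth0 E1 E3.
case: lookup => //= i [<-]; eexists; first by [].
rewrite /exec; case: (imove i); split=> //= -[|[|j]] //=;
  by rewrite -?nth0 ?nth_behead ?E2 ?E3.
Qed.

Lemma digits_ext t t' : nth 0 t =1 nth 0 t' -> digits t = digits t'.
Proof.
elim: t t' => [|a t IH] [|a' t'] E //=.
- by have /= <- := E 0.
- by have /= -> := E 0.
- by have /= -> := E 0; rewrite (IH t') // => j; apply: (E j.+1).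
Qed.

Lemma halts_eqc M c c' y : eqc c c' -> halts M c y <-> halts M c' y.
Proof.
suff H d d' : eqc d d' -> halts M d y -> halts M d' y.
  by move=> E; split; apply: H => //; apply: eqc_sym.
move=> E [n [e [Hn Hs Hd]]]; elim: n d d' E Hn => [|n IH] d d' E.
  move=> [Ee]; exists 0, d'; split=> //; last first.
    by rewrite -Hd -Ee; apply: digits_ext => j; case: E.
  case S: (step M d') => [f|] //; have [f' ] := step_eqc (eqc_sym E) S.
  by rewrite Ee Hs.
rewrite iterSr /=; case S: (step M d) => [f|] /=; last first.
  have noneS j : iter j (obind (step M)) None = None by elim: j => //= j ->.
  by rewrite noneS.
have [f' S' E'] := step_eqc E S.
by move=> /(IH _ _ E') Hf; apply/(halts_step _ S').
Qed.

Definition shift_instr (i : instr) : instr :=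
  Instr (istate i).+1 (iread i) (inext i).+1 (iwrite i) (imove i).

Definition shift_config (c : config) : config :=
  Config (cstate c).+1 (ltape c) (rtape c).

(** Writes [r] from right to left on blank cells, one state per bit, then steps back onto the last
    bit written and enters state 1, the shifted initial state of the attached machine. For
    [r = rev v] the tape then reads [v] from the head on. *)
Fixpoint writer (q : nat) (r : seq bool) : machine :=
  if r is b :: r' then Instr q 0 q.+1 b.+1 MoveL :: writer q.+1 r'
  else [:: Instr q 0 1 0 MoveR].

Definition prelude (q : nat) (v : seq bool) : machine :=
  [:: Instr 0 0 q 0 MoveL; Instr 0 1 q 1 MoveL; Instr 0 2 q 2 MoveL] ++ writer q (rev v).

Definition bound (U : machine) : nat :=
  foldr (fun i n => maxn (maxn (istate i).+1 (inext i).+1) n) 1 U.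

(** States are kept apart: 0 is the new initial state, the shifted states of [U] lie between 1 and
    [bound U], and the writer uses larger ones. *)
Definition attach (U : machine) (v : seq bool) : machine :=
  map shift_instr U ++ prelude (bound U).+1 v.

Definition bounded (N : nat) (U : machine) : Prop :=
  forall q s i, lookup U q s = Some i -> q < N /\ inext i < N.

Lemma lookup_cons i M q s : lookup (i :: M) q s =
  if (istate i == q) && (iread i == s) then Some i else lookup M q s.
Proof. by rewrite /lookup /=; case: ifP. Qed.

Lemma lookup_cat M M' q s : lookup (M ++ M') q s =
  if lookup M q s is Some i then Some i else lookup M' q s.
Proof. by rewrite /lookup filter_cat; case: [seq i <- M | _]. Qed.

Lemma lookup_shift U q s :
  lookup (map shift_instr U) q.+1 s = omap shift_instr (lookup U q s).
Proof. by elim: U => //= i U IH; rewrite !lookup_cons IH /= eqSS; case: ifP. Qed.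

Lemma lookup_shift0 U s : lookup (map shift_instr U) 0 s = None.
Proof. by elim: U => //= i U IH; rewrite lookup_cons. Qed.

Lemma bound_gt0 U : 0 < bound U.
Proof. by elim: U => //= i U IH; rewrite leq_max IH orbT. Qed.

Lemma boundP U : bounded (bound U) U.
Proof.
elim: U => [|i U IH] q s j; first by [].
rewrite lookup_cons /= !leq_max; case: ifP => [/andP[/eqP<- _] [<-]|_ /IH[-> ->]].
  by rewrite !leqnn !orbT.
by rewrite !orbT.
Qed.

Lemma lookup_writer_out q q' s r : q' < q -> lookup (writer q r) q' s = None.
Proof.
elim: r q => [|b r IH] q lt; rewrite /= lookup_cons /= (gtn_eqF lt) //=.
by rewrite IH // ltnW.
Qed.

Section Attach.
Variables (U : machine) (v : seq bool).
Let M := attach U v.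

Lemma lookup_attach q s : q < bound U ->
  lookup M q.+1 s = omap shift_instr (lookup U q s).
Proof.
move=> lt; rewrite /M /attach lookup_cat lookup_shift.
case: lookup => //=; rewrite /prelude !lookup_cons /=.
by rewrite lookup_writer_out.
Qed.

Lemma lookup_attach_high q s : bound U < q ->
  lookup M q s = lookup (writer (bound U).+1 (rev v)) q s.
Proof.
case: q => // q lt; rewrite /M /attach lookup_cat lookup_shift.
by case E: (lookup U q s) => [i|] //=; have [] := boundP E; lia.
Qed.

Lemma step_attach c : cstate c < bound U ->
  step M (shift_config c) = omap shift_config (step U c) /\
  (forall d, step U c = Some d -> cstate d < bound U).
Proof.
move=> lt; rewrite /step lookup_attach //=.
case E: lookup => [i|] //=; have [_ lti] := boundP E; split.
  by rewrite /exec /=; case: (imove i).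
by move=> d [<-]; rewrite /exec; case: (imove i).
Qed.

Lemma iter_attach n c : cstate c < bound U ->
  iter n (obind (step M)) (Some (shift_config c)) =
    omap shift_config (iter n (obind (step U)) (Some c)) /\
  (forall d, iter n (obind (step U)) (Some c) = Some d -> cstate d < bound U).
Proof.
move=> lt; elim: n => [|n [IH1 IH2]]; first by split=> // d [<-].
rewrite !iterS IH1; case E: (iter n _ (Some c)) IH2 => [d|] /= IH2; last by [].
exact: step_attach (IH2 d erefl).
Qed.

Lemma halts_attach c y : cstate c < bound U ->
  halts M (shift_config c) y <-> halts U c y.
Proof.
move=> lt; split=> -[n [d [Hn Hs Hd]]]; have [E1 E2] := iter_attach n lt.
  move: Hn; rewrite E1; case E: (iter n (obind (step U)) (Some c)) E2 => [e|] //= /(_ e erefl) lte [Ed].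
  exists n, e; split=> //; last by rewrite -Hd -Ed.
  by move: Hs; rewrite -Ed (step_attach lte).1; case: step.
exists n, (shift_config d); split=> //; first by rewrite E1 Hn.
by rewrite (step_attach (E2 d Hn)).1 Hs.
Qed.

Lemma halts_writer q r t y : bound U < q ->
  (forall q' s, q <= q' -> lookup M q' s = lookup (writer q r) q' s) ->
  halts M (Config q [::] (0 :: t)) y <->
  halts M (Config 1 [:: 0] ([seq (nat_of_bool b).+1 | b <- rev r] ++ t)) y.
Proof.
elim: r q t => [|b r IH] q t lt H.
  apply: halts_step; rewrite /step H //= lookup_cons !eqxx //.
have S : step M (Config q [::] (0 :: t)) = Some (Config q.+1 [::] (0 :: b.+1 :: t)).
  by rewrite /step H //= lookup_cons !eqxx.
rewrite (halts_step _ S) IH; first by rewrite rev_cons map_rcons cat_rcons.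
  by rewrite ltnW.
move=> q' s le; rewrite H 1?ltnW //= lookup_cons /=.
by rewrite (ltn_eqF le).
Qed.

Lemma computes_attach p y : computes M p y <-> computes U (v ++ p) y.
Proof.
rewrite -[computes M p y]/(halts M (init p) y) -[computes U _ y]/(halts U (init (v ++ p)) y).
have S : step M (init p) =
    Some (Config (bound U).+1 [::] (0 :: head 0 (rtape (init p)) :: behead (rtape (init p)))).
  rewrite /step /M /attach lookup_cat lookup_shift0 /prelude /= !lookup_cons /=.
  by case: p => [|[] p].
rewrite (halts_step _ S) (halts_writer (r := rev v)) //; last first.
  by move=> q' s le; rewrite lookup_attach_high.
(* The prelude leaves an explicit blank on the left, and another on the right when [p] is empty, so
   the tape agrees with that of [init (v ++ p)] only up to [eqc]. *)
rewrite -halts_attach ?bound_gt0 //; apply: halts_eqc; split=> //= [[|[]] //|j].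
rewrite revK map_cat !nth_cat; case: ltnP => // _.
by case: p {S} => // ; case: (j - _) => //= -[].
Qed.

End Attach.

Lemma cf_code_nat {A : Type} {EA : Enc A} (n : A -> nat) :
  cf n -> cf (fun a => code_nat (n a)).
Proof.
move=> N; apply: (@cf_ext _ _ _ _ (fun a => nseq (n a) true ++ [:: false])).
  by move=> a; rewrite /code_nat cats1.
by cf_auto.
Qed.

(** [U] is fixed, so its part of the code is a constant word; only the writer depends on [w], and a
    fold that carries the next state number emits its instructions. *)
Lemma cf_code_attach (U : machine) : cf (fun w => code (attach U (delimit w))).
Proof.
pose wr (s : seq bool * nat) (b : bool) :=
  (s.1 ++ (code_nat s.2 ++ code_nat 0 ++ code_nat s.2.+1 ++ code_nat b.+1 ++ [:: false]),
   s.2.+1).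
pose fin (s : seq bool * nat) :=
  s.1 ++ (code_nat s.2 ++ code_nat 0 ++ code_nat 1 ++ code_nat 0 ++ [:: true]).
pose B := (bound U).+1.
pose pre := code (map shift_instr U ++
  [:: Instr 0 0 B 0 MoveL; Instr 0 1 B 1 MoveL; Instr 0 2 B 2 MoveL]).
apply: (@cf_ext _ _ _ _ (fun w => pre ++ fin (foldl wr ([::], B) (rev (delimit w))))).
  move=> w; rewrite /attach /prelude catA {1}/code map_cat flatten_cat.
  congr (_ ++ _); rewrite -/B.
  suff H acc q r : fin (foldl wr (acc, q) r) = acc ++ code (writer q r) by rewrite H.
  elim: r acc q => [|b r IH] acc q; first by rewrite /fin /code /= cats0.
  by rewrite /= /wr /= IH /code /= -!catA.
rewrite /fin /wr; repeat first [progress cf_auto | simple apply cf_code_nat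
  | exact: (cf_delimit cf_id)].
Qed.

Theorem effective_search : exists (F : machine) (C : machine -> machine),
  forall V, computes F (code V) (code (C V)) /\
    forall p,
    (forall t y, hit V p t = Some y -> (forall m, m < t -> hit V p m = None) ->
       computes (C V) p y) /\
    ((forall t, hit V p t = None) -> ~ dom (C V) p).
Proof.
have [U HU] := universal_searcher; have [F HF] := total_machine (cf_code_attach U).
exists F, (fun V => attach U (delimit (code V))) => V; split; first exact: HF.
move=> p; have [H1 H2] := HU V p; split=> [t y Hy lt|Hn].
  by apply/computes_attach; apply: H1 Hy lt.
by move=> [y /computes_attach Hy]; apply: (H2 Hn); exists y.
Qed.

(** * Counting dyadic intervals *)

Fixpoint words (k : nat) : seq (seq bool) :=
  if k is k'.+1 then
    flatten [seq [:: rcons p false; rcons p true] | p <- words k']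
  else [:: [::]].

Lemma mem_words p k : (p \in words k) = (size p == k).
Proof.
elim: k p => [|k IH] p; first by case: p.
apply/flatten_mapP/eqP => [[q]|].
  rewrite IH => /eqP Eq; rewrite !inE => /orP[]/eqP ->; by rewrite size_rcons Eq.
elim/last_ind: p => // p b _; rewrite size_rcons => -[Ep].
by exists p; rewrite ?IH ?Ep // !inE; case: b; rewrite eqxx ?orbT.
Qed.

Lemma val2_rcons p b : val2 (rcons p b) = val2 p + val2 p + b.
Proof. by rewrite /val2 foldl_rcons. Qed.

(** The words of length [k] are listed by increasing value, which turns counting dyadic intervals
    into counting integers. *)
Lemma map_val2_words k : [seq val2 p | p <- words k] = iota 0 (2 ^ k).
Proof.
elim: k => //= k IH; rewrite map_flatten -map_comp.
transitivity (flatten [seq [:: i + i; (i + i).+1] | i <- iota 0 (2 ^ k)]).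
  rewrite -IH -map_comp; congr flatten; apply: eq_map => p /=.
  by rewrite !val2_rcons addn0 addn1.
rewrite expnS mul2n -addnn.
suff H j m : flatten [seq [:: i + i; (i + i).+1] | i <- iota j m] = iota (j + j) (m + m).
  exact: (H 0).
by elim: m j => //= m IHm j; rewrite IHm addnS addSn /= addnS.
Qed.

Lemma uniq_words k : uniq (words k).
Proof. by apply: (@map_uniq _ _ val2); rewrite map_val2_words iota_uniq. Qed.

Lemma parent_rcons p b : parent (rcons p b) = p.
Proof. by rewrite /parent rev_rcons /= revK. Qed.

(** A word of [D] of length [k + 1] either has its parent in [D], and then so does its sibling, or
    is minimal. *)
Lemma count_minimal (D : seq bool -> bool) k :
  (forall p b, D p -> D (rcons p b)) ->
  count D (words k.+1) = (count D (words k)).*2 + count (minimal D) (words k.+1).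
Proof.
move=> up /=; elim: (words k) => //= p s IH; rewrite IH.
have mE b : minimal D (rcons p b) = D (rcons p b) && ~~ D p.
  by rewrite /minimal parent_rcons size_rcons.
rewrite !mE; case Dp: (D p); first by rewrite !(up p) //=; lia.
by rewrite !andbT; lia.
Qed.

Local Open Scope classical_set_scope.
Section RealCounting.
Variable R : realType.
Local Open Scope ring_scope.

(** By [count_minimal] the sum telescopes: the minimal words of length at most [k] cover the same
    length as the words of [D] of length exactly [k]. *)
Lemma sum_minimal (D : seq bool -> bool) k :
  (forall p b, D p -> D (rcons p b)) ->
  \sum_(j < k.+1) (count (minimal D) (words j))%:R / 2 ^+ j =
  (count D (words k))%:R / 2 ^+ k :> R.
Proof.
move=> up; elim: k => [|k IH].
  by rewrite big_ord_recr big_ord0 /= /minimal /= andbT add0r.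
rewrite big_ord_recr IH /= [in RHS](count_minimal k up) natrD -muln2 natrM exprS.
field; rewrite expf_neq0 //=; lra.
Qed.

Lemma count_iota_ge (x y : R) (N : nat) : 0 <= x -> N%:R <= y ->
  N%:R - x - 1 <= (count (fun i : nat => (x <= i%:R) && (i.+1%:R <= y)) (iota 0 N))%:R.
Proof.
move=> x0; elim: N => [|N IH] Ny; first by rewrite /=; lra.
have NN : N.+1%:R = N%:R + 1 :> R by rewrite -addn1 natrD.
rewrite -[in iota 0 N.+1]addn1 iotaD count_cat natrD /= add0n Ny andbT addn0 NN.
have {}IH : N%:R - x - 1 <= (count (fun i : nat => (x <= i%:R) && (i.+1%:R <= y)) (iota 0 N))%:R.
  by apply: IH; move: Ny; rewrite NN; lra.
case: (lerP x N%:R) => H /=; first by rewrite mulr1n; lra.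
rewrite mulr0n addr0; apply: le_trans (ler0n _ _); lra.
Qed.

Lemma count_iota_le (x y : R) (N : nat) : x <= y ->
  (count (fun i : nat => (x <= i%:R) && (i.+1%:R <= y)) (iota 0 N))%:R <= y - x.
Proof.
move=> xy; set c := fun i : nat => _.
(* The bound is strengthened so that induction on [N] applies: only the part of the interval below
   [N] has been counted. *)
suff H : (count c (iota 0 N))%:R <= Num.max 0 (Num.min y N%:R - x).
  by apply: le_trans H _; rewrite ge_max subr_ge0 xy lerD2r ge_min lexx.
elim: N => [|N IH]; first by rewrite /= le_max lexx.
have NN : N.+1%:R = N%:R + 1 :> R by rewrite -addn1 natrD.
rewrite -[in iota 0 N.+1]addn1 iotaD count_cat natrD /= add0n addn0.
move: IH; set C : R := (count _ _)%:R; rewrite /c.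
case: (boolP (_ && _)) => [/andP[xN Ny]|_] /=.
  rewrite mulr1n min_r; last by rewrite (le_trans _ Ny) // NN lerDl.
  rewrite max_r ?subr_ge0 // min_r // NN => H.
  by rewrite le_max; apply/orP; right; lra.
rewrite mulr0n addr0 => H; apply: (le_trans H).
rewrite ge_max le_max lexx /= le_max; apply/orP; right.
by rewrite lerD2r le_min !ge_min lexx /= NN lerDl ler01 orbT.
Qed.

(* [[left_end p, right_end p)] is the dyadic interval of [p], the set of the reals
   of [[0, 1)] with a binary expansion that starts with [p]. *)
Definition left_end (p : seq bool) : R := (val2 p)%:R / 2 ^+ size p.
Definition right_end (p : seq bool) : R := (val2 p).+1%:R / 2 ^+ size p.

Definition fits (a b : R) (p : seq bool) : bool :=
  (a <= left_end p) && (right_end p <= b).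

Lemma left_end_lt p : left_end p < right_end p.
Proof. by rewrite /left_end /right_end ltr_pM2r ?invr_gt0 ?exprn_gt0 // ltr_nat. Qed.

Lemma left_end_rcons p b : left_end p <= left_end (rcons p b).
Proof.
have k0 : 0 < 2 ^+ size p :> R by rewrite exprn_gt0.
rewrite /left_end size_rcons val2_rcons exprS ler_pdivlMr ?mulr_gt0 //.
rewrite mulrCA divfK ?gt_eqF // !natrD.
by have := ler0n R b; lra.
Qed.

Lemma right_end_rcons p b : right_end (rcons p b) <= right_end p.
Proof.
have k0 : 0 < 2 ^+ size p :> R by rewrite exprn_gt0.
rewrite /right_end size_rcons val2_rcons exprS ler_pdivrMr ?mulr_gt0 //.
rewrite mulrCA divfK ?gt_eqF // -2!natr1 !natrD.
have : (b <= 1)%N by case: b.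
by rewrite -(ler_nat R); lra.
Qed.

Lemma fits_rcons a b p c : fits a b p -> fits a b (rcons p c).
Proof.
move=> /andP[H1 H2]; rewrite /fits (le_trans H1) ?left_end_rcons //.
by rewrite (le_trans (right_end_rcons _ _)).
Qed.

Lemma count_fits a b k :
  count (fits a b) (words k) =
  count (fun i : nat => (a * 2 ^+ k <= i%:R) && (i.+1%:R <= b * 2 ^+ k)) (iota 0 (2 ^ k)).
Proof.
rewrite -map_val2_words count_map; apply: eq_in_count => p.
rewrite mem_words => /eqP sp; rewrite /fits /left_end /right_end sp /=.
by rewrite ler_pdivlMr ?exprn_gt0 // ler_pdivrMr ?exprn_gt0.
Qed.

Lemma count_fits_le a b k : a <= b ->
  (count (fits a b) (words k))%:R / 2 ^+ k <= b - a.
Proof.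
move=> ab; rewrite ler_pdivrMr ?exprn_gt0 // count_fits mulrBl.
by apply: count_iota_le; rewrite ler_pM2r // exprn_gt0.
Qed.

(** Fewer than two cells of length [2 ^- k] are lost, counting both ends of the interval. *)
Lemma count_fits_gt a b k : 0 <= a -> a <= b -> b <= 1 ->
  b - a - 2 / 2 ^+ k < (count (fits a b) (words k))%:R / 2 ^+ k.
Proof.
move=> a0 ab b1; have k0 : 0 < 2 ^+ k :> R by rewrite exprn_gt0.
rewrite ltr_pdivlMr // mulrBl divfK ?gt_eqF // mulrBl count_fits.
set x := a * _; set y := b * _.
have x0 : 0 <= x by rewrite mulr_ge0 // ltW.
have y0 : 0 <= y by apply: mulr_ge0; [apply: le_trans ab | apply: ltW].
(* [count_iota_ge] needs a range that ends below [y], so the range is cut at the integer part [h];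
   [b <= 1] puts [h] within it. *)
have /andP[hy yh] := truncn_itv y0; set h := Num.trunc y in hy yh.
have hN : (h <= 2 ^ k)%N.
  rewrite -(ler_nat R) natrX; apply: (le_trans hy).
  by rewrite /y -[leRHS]mul1r ler_pM2r.
rewrite -(subnKC hN) iotaD count_cat natrD.
have := count_iota_ge x0 hy.
have NN : h.+1%:R = h%:R + 1 :> R by rewrite -addn1 natrD.
move: (ler0n R (count (fun i : nat => (x <= i%:R) && (i.+1%:R <= y)) (iota (0 + h) (2 ^ k - h)))).
by rewrite NN in yh; lra.
Qed.

(** Grouping the minimal words by length gives a series whose partial sums are known from
    [sum_minimal]. *)
Lemma minimal_esum (D : seq bool -> bool) :
  (forall p b, D p -> D (rcons p b)) ->
  (fun k => ((count D (words k))%:R / 2 ^+ k : R)%:E) @ \oo -->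
  (\esum_(p in [set p | minimal D p]) ((2 : R) ^- size p)%:E)%E.
Proof.
move=> up; set A : set (seq bool) := [set p | minimal D p].
pose J k := [set` [seq p <- words k | minimal D p]].
have JP k p : J k p <-> size p = k /\ minimal D p.
  rewrite -[J k p]/(is_true (p \in [seq q <- words k | minimal D q])).
  by rewrite mem_filter mem_words; split=> [/andP[? /eqP]|[/eqP-> ->]].
have -> : A = \bigcup_(k in [set: nat]) J k.
  apply/seteqP; split=> [p mp|p [k _ /JP[]] //].
  by exists (size p) => //; apply/JP.
rewrite esum_bigcupT; last 2 first.
- apply/trivIsetP => i j _ _ /eqP ij; apply/seteqP; split=> p //= -[].
  by move=> /JP[Ei _] /JP[Ej _]; case: ij; rewrite -Ei -Ej.
- by move=> p; rewrite lee_fin invr_ge0 exprn_ge0.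
have EJ k : (\esum_(p in J k) ((2 : R) ^- size p)%:E)%E =
    ((count (minimal D) (words k))%:R / 2 ^+ k)%:E.
  rewrite esum_fset; [|exact: finite_seq|by move=> p _; rewrite lee_fin invr_ge0 exprn_ge0].
  rewrite -fsbig_seq ?filter_uniq ?uniq_words // sumEFin; congr EFin.
  rewrite big_filter big_seq_cond (eq_bigr (fun=> 2 ^- k)); last first.
    by move=> p /andP[]; rewrite mem_words => /eqP ->.
  rewrite -big_seq_cond big_const_seq iter_addr_0.
  by rewrite mulr_natl.
under eq_esum do rewrite EJ.
have ge0 k : (0 <= ((count (minimal D) (words k))%:R / 2 ^+ k : R)%:E)%E.
  by rewrite lee_fin divr_ge0 // exprn_ge0.
rewrite -nneseries_esumT //.
pose a i : \bar R := ((count (minimal D) (words i))%:R / 2 ^+ i)%:E.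
have : (fun n => \sum_(0 <= i < n) a i)%E @ \oo --> (\sum_(0 <= i <oo) a i)%E.
  exact: (@is_cvg_nneseries R _ xpredT 0 (fun n _ _ => ge0 n)).
(* Level [k] corresponds to the partial sum over the lengths [0] to [k], which has [k + 1] terms. *)
rewrite -cvg_shiftS; apply: cvg_trans; apply: near_eq_cvg; near=> k.
by rewrite /a /= sumEFin big_mkord sum_minimal.
Unshelve. all: by end_near. Qed.

(** The covered length at level [k] lies between [b - a - 2 / 2 ^ k] and [b - a], so its limit is
    [b - a]. *)
Lemma esum_fits a b : 0 <= a -> a <= b -> b <= 1 ->
  (\esum_(p in [set p | minimal (fits a b) p]) ((2 : R) ^- size p)%:E)%E = (b - a)%:E.
Proof.
move=> a0 ab b1.
have up := @fits_rcons a b.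
have half : `|2^-1 : R| < 1 by rewrite ger0_norm ?invr_ge0 // invf_lt1 // ltrDl ltr01.
apply: cvg_unique (minimal_esum up) _ => //.
apply: cvg_EFin; first exact: nearW.
apply: (@squeeze_cvgr _ _ _ _ (fun k => b - a - 2 * 2^-1 ^+ k) (fun=> b - a)).
- apply: nearW => k /=; rewrite count_fits_le // andbT exprVn ltW //.
  exact: count_fits_gt.
- have /(@cvgMl_tmp R nat \oo _ _ 2 0) := cvg_expr half.
  by rewrite mulr0 => /(cvgB (cvg_cst (b - a))); rewrite subr0; apply.
- by apply: (cvg_cst (b - a)).
Qed.

(** The sum is the limit of the proportion of words of length [k] that belong to [D], which never
    exceeds 1. *)
Lemma kraft (D : seq bool -> bool) : (forall p b, D p -> D (rcons p b)) ->
  (\esum_(p in [set p | minimal D p]) ((2 : R) ^- size p)%:E <= 1)%E.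
Proof.
move=> up; have H := minimal_esum up.
rewrite -(cvg_lim _ H) //; apply: lime_le; first by apply/cvg_ex; eexists; exact: H.
apply: nearW => k; rewrite lee_fin ler_pdivrMr ?exprn_gt0 // mul1r -natrX ler_nat.
by rewrite -(size_iota 0 (2 ^ k)) -map_val2_words size_map count_size.
Qed.

End RealCounting.
Local Open Scope classical_set_scope.

(** * The self-delimiting machine *)

(** The fold starts from 1, the leading digit that [bin] removes. *)
Definition unbin (x : seq bool) : nat := foldl (fun a (b : bool) => a + a + b) 1 x.

Lemma unbin_rcons x b : unbin (rcons x b) = unbin x + unbin x + b.
Proof. by rewrite /unbin foldl_rcons. Qed.

Lemma unbin_gt0 x : 0 < unbin x.
Proof. by elim/last_ind: x => // x b IH; rewrite unbin_rcons; lia. Qed.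

Lemma unbinK x : bin (unbin x) = x.
Proof.
elim/last_ind: x => [|x b IH]; first exact: bin1.
have u0 := unbin_gt0 x; rewrite unbin_rcons bin_half; last by lia.
rewrite addnn halfD odd_double doubleK oddD odd_double /= add0n.
by rewrite (_ : (b : nat)./2 = 0) ?addn0 ?IH; case: b.
Qed.

Lemma binK n : 0 < n -> unbin (bin n) = n.
Proof.
elim/ltn_ind: n => n IH n0; case: (leqP n 1) => [le1|lt1].
  by have -> : n = 1 by lia.
rewrite bin_half // unbin_rcons IH ?half_gt0 //; last first.
  by rewrite ltn_half_double -addnn -[X in X < _]addn0 ltn_add2l.
by rewrite addnn addnC odd_double_half.
Qed.

Lemma size_bin n : size (bin n) = trunc_log 2 n.
Proof. by rewrite /bin size_mkseq. Qed.

Lemma minimal_exists (D : seq bool -> bool) q :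
  D q -> exists2 p, size p <= size q & minimal D p.
Proof.
elim/last_ind: q => [|q b IH] Dq; first by exists [::]; rewrite /minimal ?Dq.
case Dq' : (D q).
  by have [p le mp] := IH Dq'; exists p => //; rewrite size_rcons ltnW.
by exists (rcons q b) => //; rewrite /minimal Dq parent_rcons Dq' orbT.
Qed.

Lemma eq_minimal (D D' : seq bool -> bool) : D =1 D' -> minimal D =1 minimal D'.
Proof. by move=> E p; rewrite /minimal !E. Qed.

Lemma halting_time_unique M a n m c d :
  iter n (obind (step M)) (Some a) = Some c -> step M c = None ->
  iter m (obind (step M)) (Some a) = Some d -> step M d = None -> n = m.
Proof.
wlog lt : n m c d / n < m.
  move=> W Hn Hc Hm Hd; case: (ltngtP n m) => // lt; first exact: W Hn Hc Hm Hd.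
  exact/esym/(W _ _ _ _ lt Hm Hd Hn Hc).
have noneS j : iter j (obind (step M)) None = None by elim: j => //= j ->.
move=> Hn Hc; have -> : m = m - n.+1 + n.+1 by rewrite subnK.
by rewrite iterD iterS Hn /= Hc noneS.
Qed.

(** * Claimed intervals and their partial sums *)

Section Fire.
Variable V : machine.

Lemma fireP t n y : fire V t = Some (n, y) ->
  exists c, [/\ n = (unpair t).1.+1, run V (unpair t).1 (unpair t).2 = Some c,
               step V c = None & digits (rtape c) = y].
Proof.
rewrite /fire; case: run => [c|] //; case Hc: (step V c) => // -[<- <-].
by exists c.
Qed.

Lemma fire_gt0 t n y : fire V t = Some (n, y) -> 0 < n.
Proof. by move=> /fireP[c [-> _ _ _]]. Qed.

Lemma fire_computes t n y : fire V t = Some (n, y) -> computes V (bin n) y.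
Proof. by move=> /fireP[c [-> Hr Hs Hd]]; exists (unpair t).2, c. Qed.

(** A halting time is unique, so each [n] claims only one interval. *)
Lemma fire_inj t t' n y y' :
  fire V t = Some (n, y) -> fire V t' = Some (n, y') -> t = t'.
Proof.
move=> /fireP[c [En Hr Hs _]] /fireP[c' [En' Hr' Hs' _]].
have E1 : (unpair t).1 = (unpair t').1 by apply: succn_inj; rewrite -En.
rewrite -(unpairK t) -(unpairK t') E1; congr pair_nat.
by rewrite E1 in Hr; apply: halting_time_unique Hr Hs Hr' Hs'.
Qed.

Lemma fire_surj n y : 0 < n -> computes V (bin n) y -> exists t, fire V t = Some (n, y).
Proof.
case: n => // n _ [s [c [Hr Hs Hd]]]; exists (pair_nat n s).
by rewrite /fire pair_natK /= /run Hr Hs Hd.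
Qed.

Lemma fracS t : frac V t.+1 =
  if fire V t is Some q then
    ((frac V t).1 * q.1 + (frac V t).2, (frac V t).2 * q.1)
  else frac V t.
Proof.
rewrite /frac; set F := fun s : nat * (nat * nat) => _.
have E k : (iter k F (0, (0, 1))).1 = k by elim: k => //= k ->.
by rewrite iterS {1}/F E /=.
Qed.

Lemma frac_gt0 t : 0 < (frac V t).2.
Proof.
elim: t => // t IH; rewrite fracS; case E: (fire V t) => [[n y]|] //=.
by rewrite muln_gt0 IH (fire_gt0 E).
Qed.

Section Real.
Variable R : realType.
Local Open Scope ring_scope.

(** The left end of the interval claimed at stage [t], if there is one; its right end is
    [psum t.+1]. *)
Definition psum (t : nat) : R := (frac V t).1%:R / (frac V t).2%:R.

Lemma psum_fire t n y : fire V t = Some (n, y) -> psum t.+1 = psum t + n%:R^-1.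
Proof.
move=> E; have n0 := fire_gt0 E; have d0 := frac_gt0 t.
rewrite /psum fracS E /= natrD !natrM.
by field; rewrite !pnatr_eq0 -!lt0n n0 d0.
Qed.

Lemma psumS t : psum t.+1 = psum t + (if fire V t is Some q then q.1%:R^-1 else 0).
Proof.
case E: (fire V t) => [[n y]|]; first exact: psum_fire E.
by rewrite /psum fracS E addr0.
Qed.

Lemma psum_sum t :
  psum t = \sum_(0 <= i < t) (if fire V i is Some q then q.1%:R^-1 else 0).
Proof.
elim: t => [|t IH]; first by rewrite big_geq // /psum /= mul0r.
by rewrite psumS IH big_nat_recr.
Qed.

Lemma psum_mono t t' : (t <= t')%N -> psum t <= psum t'.
Proof.
move/subnK <-; elim: (t' - t)%N => // k; rewrite addSn psumS => H.
by apply: (le_trans H); rewrite lerDl; case: fire => // q; rewrite invr_ge0.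
Qed.

Lemma psum_ge0 t : 0 <= psum t.
Proof. by rewrite /psum divr_ge0. Qed.

(** Multiplying by the positive denominators identifies the test on natural numbers, which the
    machine performs, with the comparison of reals. *)
Lemma inside_fits t n y : fire V t = Some (n, y) ->
  inside (frac V t) n =1 fits (psum t) (psum t.+1).
Proof.
move=> E p; have n0 := fire_gt0 E; have d0 := frac_gt0 t.
have k0 : 0 < 2 ^+ size p :> R by rewrite exprn_gt0.
have n0' : 0 < n%:R :> R by rewrite ltr0n.
have d0' : 0 < (frac V t).2%:R :> R by rewrite ltr0n.
rewrite /inside /fits /left_end /right_end /psum fracS E /=; congr andb.
  rewrite ler_pdivrMr // mulrAC ler_pdivlMr //.
  by rewrite -natrX -!natrM ler_nat.
rewrite ler_pdivrMr // mulrAC ler_pdivlMr; last by rewrite natrM mulr_gt0.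
by rewrite -natrX -!natrM ler_nat.
Qed.

Lemma hitP p t y : hit V p t = Some y <->
  exists2 n, fire V t = Some (n, y) & minimal (fits (psum t) (psum t.+1)) p.
Proof.
rewrite /hit; case E: (fire V t) => [[n z]|]; last by split=> // -[].
rewrite (eq_minimal (inside_fits E)).
case: minimal; split=> //; first by move=> [<-]; exists n.
- by move=> [n' [_ <-]].
- by case.
Qed.

Lemma end_prefix p q : prefix p q -> left_end R p <= left_end R q /\ right_end R q <= right_end R p.
Proof.
case/prefixP => r ->; elim/last_ind: r => [|r b [IH1 IH2]]; first by rewrite cats0.
rewrite -rcons_cat (le_trans IH1 (left_end_rcons _ _ _)).
by rewrite (le_trans (right_end_rcons _ _ _) IH2).
Qed.

Lemma minimal_sub (D : seq bool -> bool) p : minimal D p -> D p.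
Proof. by case/andP. Qed.

(** The interval of [q] lies in that of [p] and is not degenerate, while the intervals claimed at
    distinct stages do not overlap because [psum] is monotone. *)
Lemma fits_disjoint t t' p q : prefix p q ->
  fits (psum t) (psum t.+1) p -> fits (psum t') (psum t'.+1) q -> t = t'.
Proof.
move=> /end_prefix[H1 H2] /andP[P1 P2] /andP[Q1 Q2].
have lp := left_end_lt R p; have lq := left_end_lt R q.
by case: (ltngtP t t') => // /psum_mono lt; exfalso; lra.
Qed.

Lemma hit_prefix p q t t' y y' : prefix p q ->
  hit V p t = Some y -> hit V q t' = Some y' -> p = q /\ t = t'.
Proof.
move=> pq /hitP[n _ mp] /hitP[n' _ mq].
have E := fits_disjoint pq (minimal_sub mp) (minimal_sub mq); split=> //.
case/prefixP: pq mq => r ->; rewrite -E; case/lastP: r => [|r b]; first by rewrite cats0.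
(* If [q] were a proper extension of [p], its parent would still extend [p], hence fit, against the
   minimality of [q]. *)
rewrite -rcons_cat /minimal parent_rcons size_rcons /= => /andP[_ /negP[]].
have := minimal_sub mp; elim/last_ind: r => [|r c IH]; first by rewrite cats0.
by rewrite -rcons_cat => /IH; apply: fits_rcons.
Qed.

Definition firing : set nat := [set t | exists q, fire V t = Some q].

(** The stages that fire correspond one to one to the numbers [n] such that [V] halts on [bin n]. *)
Lemma zeta_firing : zeta R V =
  (\esum_(t in firing) (if fire V t is Some q then q.1%:R^-1 else 0 : R)%:E)%E.
Proof.
pose e t := (unpair t).1.+1.
have fe t n y : fire V t = Some (n, y) -> e t = n by move=> /fireP[c [->]].
rewrite /zeta (@reindex_esum _ _ _ firing _ e).
  by apply: eq_esum => t [[n y] E]; rewrite E (fe _ _ _ E).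
split.
- move=> t [[n y] E]; rewrite /= (fe _ _ _ E); split; first exact: fire_gt0 E.
  by exists y; apply: fire_computes E.
- move=> t t' /set_mem[[n y] E] /set_mem[[n' y'] E'].
  by rewrite (fe _ _ _ E) (fe _ _ _ E') => Enn; rewrite Enn in E; apply: fire_inj E E'.
- move=> n /= [n0 [y Hy]]; have [t E] := fire_surj n0 Hy.
  by exists t; [exists (n, y) | apply: fe E].
Qed.

Lemma psum_le_zeta t : ((psum t)%:E <= zeta R V)%E.
Proof.
rewrite zeta_firing esum_mkcond.
have E i : (if i \in firing then (if fire V i is Some q then q.1%:R^-1 else 0 : R)%:E else 0%E)
    = (if fire V i is Some q then q.1%:R^-1 else 0 : R)%:E.
  case: ifPn => // /negP H; case F: (fire V i) => [q|] //; case: H.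
  by apply/mem_set; exists q.
rewrite (eq_esum (fun i _ => E i)) -nneseries_esumT; last first.
  by move=> i; case: fire => [q|] //; rewrite lee_fin invr_ge0.
rewrite psum_sum -sumEFin; apply: nneseries_lim_ge => i _ _.
by case: fire => [q|] //; rewrite lee_fin invr_ge0.
Qed.

End Real.
End Fire.

(** * The constructed machine: prefix-freeness, halting sum and short programs *)

Section Construction.
Variables (R : realType) (V C : machine).
Hypothesis tV : tuatara R V.
Hypothesis HC : forall p,
  (forall t y, hit V p t = Some y -> (forall m, m < t -> hit V p m = None) ->
     computes C p y) /\
  ((forall t, hit V p t = None) -> ~ dom C p).
Local Open Scope ring_scope.

Lemma psum_le1 t : psum V R t <= 1.
Proof. by rewrite -lee_fin; apply: le_trans (psum_le_zeta V R t) tV. Qed.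

(** The machine answers at the first hit, and [hit_prefix] applied to [p] and itself shows that a
    word is hit at one stage only. *)
Lemma computes_hit p t y : hit V p t = Some y -> computes C p y.
Proof.
move=> Hy; have [H _] := HC p; apply: (H t) => // m lt.
case Hm: (hit V p m) => [z|] //.
by have [_ E] := hit_prefix R (prefix_refl p) Hm Hy; rewrite E ltnn in lt.
Qed.

Lemma dom_hit p : dom C p <-> exists t y, hit V p t = Some y.
Proof.
split=> [Hd|[t [y /computes_hit Hy]]]; last by exists y.
apply: contrapT => H; have [_ H2] := HC p; apply: H2 => // t.
by case E: (hit V p t) => [y|] //; case: H; exists t, y.
Qed.

Lemma construction_self_delimiting : self_delimiting C.
Proof.
move=> p q /dom_hit[t [y Hp]] /dom_hit[t' [y' Hq]] pq.
by have [] := hit_prefix R pq Hp Hq.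
Qed.

Lemma construction_Omega : Omega R C = zeta R V.
Proof.
(* [dom C] is the disjoint union of the sets [J t] of the words hit at stage [t]; by [esum_fits],
   each contributes the length of the claimed interval. *)
pose J t : set (seq bool) :=
  [set p | firing V t /\ minimal (fits (psum V R t) (psum V R t.+1)) p].
have hitJ t p : (exists y, hit V p t = Some y) <-> J t p.
  split=> [[y /(hitP V R _ _ _)[n E m]]|[[[n y] E] m]]; first by split=> //; exists (n, y).
  by exists y; apply/(hitP V R _ _ _); exists n.
rewrite zeta_firing /Omega.
have -> : dom C = \bigcup_(t in firing V) J t.
  apply/seteqP; split=> [p /dom_hit[t Ht]|p [t _ /hitJ Ht]].
    by have Jt : J t p by [apply/hitJ]; exists t => //; case: Jt.
  by apply/dom_hit; exists t.
rewrite esum_bigcupT; last 2 first.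
- apply/trivIsetP => t t' _ _ /eqP tt'; apply/seteqP; split=> p //= -[].
  move=> /hitJ[y Hy] /hitJ[y' Hy']; apply: tt'.
  by have [] := hit_prefix R (prefix_refl p) Hy Hy'.
- by move=> p; rewrite lee_fin invr_ge0 exprn_ge0.
apply: eq_esum => t Ft; have [[n y] E] := Ft; rewrite E.
have -> : J t = [set p | minimal (fits (psum V R t) (psum V R t.+1)) p].
  by apply/seteqP; split=> p /=; [case | split].
rewrite esum_fits ?psum_ge0 ?psum_le1 ?psum_mono //.
by rewrite (psum_fire R E) addrC addKr.
Qed.

Lemma construction_short p y : computes V p y ->
  exists2 q, (size q <= size p + 2)%N & computes C q y.
Proof.
set n := unbin p; rewrite -(unbinK p) -/n => Hy.
have n0 : (0 < n)%N := unbin_gt0 p.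
(* From [n < 2 ^ (size (bin n) + 1)] follows [2 / 2 ^ k < 1 / n], so the lower bound of
   [count_fits_gt] is positive at level [k]. *)
have [t E] := fire_surj n0 Hy; set k := (size (bin n) + 2)%N.
have n0' : 0 < n%:R :> R by rewrite ltr0n.
have gt0 : 0 < psum V R t.+1 - psum V R t - 2 / 2 ^+ k.
  rewrite (psum_fire R E) [psum V R t + _]addrC addrK subr_gt0 /k addn2 !exprS invfM mulrA divff //.
  rewrite mul1r -exprS ltf_pV2 ?posrE ?exprn_gt0 // -natrX ltr_nat size_bin.
  exact: trunc_log_ltn.
have := lt_trans gt0 (count_fits_gt k (psum_ge0 V R t) (psum_mono V R (leqnSn t)) (psum_le1 _)).
(* Some word [q] of length [k] thus fits, and a prefix of it is minimal. *)
rewrite pmulr_lgt0 ?invr_gt0 ?exprn_gt0 // ltr0n -has_count => /hasP[q].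
rewrite mem_words => /eqP sq /minimal_exists[r ler mr].
exists r; first by rewrite -sq.
by apply: (@computes_hit r t); apply/(hitP V R _ _ _); exists n.
Qed.

End Construction.

(** * Self-delimiting machines are tuatara machines *)

Section Kraft.
Local Open Scope ring_scope.

(* [minimal D] contains [dom M], and [1 / n <= 2 ^- size (bin n)]. *)
Lemma self_delimiting_tuatara (R : realType) (M : machine) :
  self_delimiting M -> tuatara R M.
Proof.
move=> sd; rewrite /tuatara.
pose D p := `[< exists2 q, dom M q & prefix q p >].
have up p b : D p -> D (rcons p b).
  move=> /asboolP[q dq pq]; apply/asboolP; exists q => //.
  exact: prefix_trans pq (prefix_rcons _ _).
have sub p : dom M p -> minimal D p.
  move=> dp; apply/andP; split; first by apply/asboolP; exists p => //; apply: prefix_refl.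
  case: (lastP p) dp => [|{}p b] dp; first by [].
  apply/orP; right; apply/negP => /asboolP[q dq]; rewrite parent_rcons => pq.
  have Eq := sd _ _ dq dp (prefix_trans pq (prefix_rcons _ _)).
  by have := size_prefix pq; rewrite Eq size_rcons ltnn.
apply: le_trans (kraft R up); rewrite /zeta.
have -> : (\esum_(p in [set p | minimal D p]) ((2 : R) ^- size p)%:E =
  \esum_(n in [set n | (0 < n)%N /\ minimal D (bin n)]) ((2 : R) ^- size (bin n))%:E)%E.
  apply: reindex_esum; split.
  - by move=> n [].
  - move=> n m /set_mem[n0 _] /set_mem[m0 _] E.
    by rewrite -(binK n0) E binK.
  - by move=> p mp; exists (unbin p); rewrite /= ?unbinK //; split=> //; apply: unbin_gt0.
rewrite esum_mkcond [leRHS]esum_mkcond; apply: le_esum => n _.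
case: ifPn => [/set_mem[n0 dn]|_].
  rewrite ifT; last by apply/mem_set; split=> //; apply: sub.
  rewrite lee_fin lef_pV2 ?posrE ?ltr0n ?exprn_gt0 // -natrX ler_nat size_bin.
  exact: trunc_logP.
by case: ifP => // _; rewrite lee_fin invr_ge0 exprn_ge0.
Qed.

End Kraft.

Theorem theorem16 (R : realType) :
  effectively_exists (tuatara R)
    (fun V C => self_delimiting C /\ Omega R C = zeta R V) /\
  effectively_exists (universal_tuatara R)
    (fun V C => universal_self_delimiting C /\ Omega R C = zeta R V).
Proof.
have [F [C HFC]] := effective_search.
have base V : tuatara R V -> self_delimiting (C V) /\ Omega R (C V) = zeta R V.
  move=> tV; have [_ HC] := HFC V; split.
    exact: construction_self_delimiting R V (C V) HC.
  exact: construction_Omega tV HC.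
(* The same transformation serves both classes. *)
split; exists F => V KV; exists (C V); have [HF HC] := HFC V; split=> //.
  exact: base.
have [tV uV] := KV; have [sd Om] := base V tV; split=> //; split=> // E sdE.
(* [E] is a tuatara machine, so [V] simulates it at the cost of [c] bits; passing from [V] to [C V]
   adds two. *)
have [c Hc] := uV E (self_delimiting_tuatara R sdE).
exists (c + 2) => x y /Hc[p [lep Hp]].
have [q leq Hq] := construction_short tV HC Hp.
by exists q; split=> //; apply: leq_trans leq _; rewrite addnA leq_add2r.
Qed.
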